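(* Let $n\ge2$, let $\omega\in\mathbb{R}^n\setminus\{0\}$ and let $l:B\to\mathbb{R}$, $l(I)=\omega\cdot I$, be the associated linear integrable Hamiltonian. If $l$ is rationally steep, then $l$ is effectively stable.
   Context: $\mathbb{T}^n=\mathbb{R}^n/\mathbb{Z}^n$; $|\cdot|$ on vectors is the supremum norm. $B=B_R\subset\mathbb{R}^n$ is an open ball of radius $R>1$ for the supremum norm, $D=\mathbb{T}^n\times B$, and $\sigma>0$ is fixed. The complex neighbourhood is $V_\sigma(D)=\{(\theta,I)\in(\mathbb{C}^n/\mathbb{Z}^n)\times\mathbb{C}^n : |\mathrm{Im}\,\theta|<\sigma,\ d(I,B)<\sigma\}$, with $d$ the distance associated with the supremum norm. Perturbations $f:\mathbb{T}^n\times B\to\mathbb{R}$ are bounded real-analytic functions with a holomorphic extension to $V_\sigma(D)$, measured by $|f|=|f|_\sigma=\sup_{z\in V_\sigma(D)}|f(z)|$. The Hamiltonian system of $H$ is $\dot\theta=\partial_I H$, $\dot I=-\partial_\theta H$. Rationally steep: an integrable Hamiltonian $h:B\to\mathbb{R}$ is rationally steep if its restriction to any affine subspace of the form $I_0+\Lambda$ (intersected with $B$), with $I_0\in B$ and $\Lambda$ a linear subspace of $\mathbb{R}^n$ generated by integer vectors, has only isolated critical points. Effectively stable: an integrable Hamiltonian $h:B\to\mathbb{R}$ is effectively stable if for any $f:\mathbb{T}^n\times B\to\mathbb{R}$ with $|f|\le\varepsilon$, all solutions $(\theta(t),I(t))$ of the Hamiltonian system of $H=h+f$ starting at $(\theta_0,I_0)$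 satisfy $$\lim_{\varepsilon\to0}\left(\sup_{0\le|t|\le\varepsilon^{-1}}|I(t)-I_0|\right)=0.$$ Here the limit is understood uniformly over all such $f$ and all such solutions, the supremum being over the times $t$ with $|t|\le \varepsilon^{-1}$ for which the solution is defined in $D$. *)

(* Defs.v *)
(* Vectors are row vectors; the norm `|_| of 'rV is the supremum norm.
   Functions on T^n = R^n / Z^n (resp. on C^n / Z^n) are represented by their
   Z^n-periodic lifts to R^n (resp. to C^n), and a function on an open set by a
   total function whose values outside that set are never used. *)
From mathcomp Require Import all_boot all_order all_algebra.
From mathcomp Require Import complex.
From mathcomp Require Import all_classical all_reals all_analysis.

Set Implicit Arguments.
Unset Strict Implicit.
Unset Printing Implicit Defensive.

Import Order.TTheory GRing.Theory Num.Theory.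
Import numFieldNormedType.Exports.

Local Open Scope classical_set_scope.
Local Open Scope ring_scope.

Definition linear_hamiltonian (R : realType) (n : nat) (w : 'rV[R]_n)
    (I : 'rV[R]_n) : R :=
  \sum_(i < n) w 0 i * I 0 i.

Section RationallySteep.
Variables (R : realType) (n : nat).
Implicit Types (B : set 'rV[R]_n) (h : 'rV[R]_n -> R) (L : {vspace 'rV[R]_n}).

Definition rational_subspace L : Prop :=
  exists s : seq 'rV[int]_n, L = <<map (map_mx intr) s>>%VS.

(* The tangent space of I0 + L at any of its points is L, so that x is critical
   for the restriction iff the derivatives of h at x along L vanish. *)
Definition restriction_critical_points B h (I0 : 'rV[R]_n) L : set 'rV[R]_n :=
  [set x | [/\ B x, x - I0 \in L &
             forall v, v \in L -> is_derive x v h 0]].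

Definition rationally_steep B h : Prop :=
  forall I0 L, B I0 -> rational_subspace L ->
    let C := restriction_critical_points B h I0 L in C `<=` isolated C.

End RationallySteep.

(* The topology of a numFieldType is keyed on its coercion to a type, which is
   lost if one writes R[i] directly. *)
Definition Cplx (R : realType) : numFieldType := R[i].

Section Perturbations.
Variables (R : realType) (n : nat).
Implicit Types (B : set 'rV[R]_n) (sigma : R).

(* The norm of a normed space over R[i] takes its values in R[i]. *)
Definition rnorm (V : normedModType (Cplx R)) (v : V) : R := complex.Re `|v|.

Definition toC (x : 'rV[R]_n) : 'rV[Cplx R]_n := map_mx (real_complex R) x.

Definition intC (k : 'rV[int]_n) : 'rV[Cplx R]_n := map_mx intr k.

Definition complex_dist (z : 'rV[Cplx R]_n) B : R :=
  inf [set rnorm (z - toC x) | x in B].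

Definition complex_nbhd B sigma : set ('rV[Cplx R]_n * 'rV[Cplx R]_n) :=
  [set z | `|map_mx (@complex.Im R) z.1| < sigma /\ complex_dist z.2 B < sigma].

Definition holomorphic_on (V : set ('rV[Cplx R]_n * 'rV[Cplx R]_n))
    (F : 'rV[Cplx R]_n * 'rV[Cplx R]_n -> Cplx R) : Prop :=
  forall z, V z -> differentiable F z.

Definition holomorphic_extension B sigma (f : 'rV[R]_n -> 'rV[R]_n -> R)
    (F : 'rV[Cplx R]_n * 'rV[Cplx R]_n -> Cplx R) : Prop :=
  [/\ holomorphic_on (complex_nbhd B sigma) F,
      forall z k, complex_nbhd B sigma z -> F (z.1 + intC k, z.2) = F z
    & forall theta I, B I -> F (toC theta, toC I) = real_complex R (f theta I)].

Definition sup_norm (V : set ('rV[Cplx R]_n * 'rV[Cplx R]_n))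
    (F : 'rV[Cplx R]_n * 'rV[Cplx R]_n -> Cplx R) : \bar R :=
  ereal_sup [set (rnorm (F z))%:E | z in V].

(* For B convex, complex_nbhd B sigma is convex, hence the extension is unique
   on it and the norm of f does not depend on F. *)
Definition perturbation B sigma (eps : R) (f : 'rV[R]_n -> 'rV[R]_n -> R) : Prop :=
  exists2 F, holomorphic_extension B sigma f F &
    (sup_norm (complex_nbhd B sigma) F <= eps%:E)%E.

End Perturbations.

Section EffectivelyStable.
Variables (R : realType) (n : nat).
Implicit Types (B : set 'rV[R]_n) (sigma : R).

Definition gradient (g : 'rV[R]_n -> R) (x : 'rV[R]_n) : 'rV[R]_n :=
  \row_(i < n) 'D_('e_i) g x.

(* J is the open time interval on which the solution is considered. The angles
   are lifted to R^n, which does not affect the actions. *)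
Definition hamiltonian_solution B (H : 'rV[R]_n -> 'rV[R]_n -> R) (J : set R)
    (theta I : R -> 'rV[R]_n) : Prop :=
  [/\ open J, is_interval J, J 0 &
      forall t, J t ->
        [/\ B (I t),
            is_derive t (1 : R) theta (gradient (H (theta t)) (I t)) &
            is_derive t (1 : R) I (- gradient (H ^~ (I t)) (theta t))]].

Definition drifts B sigma (h : 'rV[R]_n -> R) (eps : R) : set R :=
  [set d | exists f J theta I t,
    [/\ perturbation B sigma eps f,
        hamiltonian_solution B (fun th K => h K + f th K) J theta I,
        J t, `|t| <= eps^-1 & d = `|I t - I 0|]].

Definition effectively_stable B sigma (h : 'rV[R]_n -> R) : Prop :=
  ereal_sup [set d%:E | d in drifts B sigma h eps] @[eps --> 0^'+] --> 0%E.

End EffectivelyStable.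

(* Main.v *)
Require Import Defs.
From mathcomp Require Import all_boot all_order all_algebra.
From mathcomp Require Import complex.
From mathcomp Require Import all_classical all_reals all_analysis.
From mathcomp Require Import ring lra zify.

(** A linear Hamiltonian w . I is rationally steep only if no nonzero integer
    vector is orthogonal to w ([rationally_steep_nonresonant]). The angles then
    move, up to a small error, along the line of direction w, which is dense in the
    torus, and the drift dI/dt = - d f / d theta averages out over this motion.

    To make this quantitative, let f be bounded by eps, and fix an index j and a
    small a > 0. By [kronecker] some multiple s w equals a e_j modulo integer
    vectors, up to a^2. Hence, by periodicity, a times the derivative of f with
    respect to theta_j is f (theta + s w) - f (theta) up to eps O(a^2)
    ([discrete_homological]), and an increment of f along w is the derivative along
    the flow of an average of f over the segment from theta to theta + s w.
    Subtracting this derivative amounts to replacing I_j by I_j plus an average of f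
    of size eps |s| / a, whose derivative is eps O(a) + eps^2 O(|s| / a)
    ([near_identity_drift]). Over a time 1 / eps the drift is therefore at most
    O(a) + O(eps |s| / a), where s depends on a but not on eps: choosing a first and
    eps afterwards makes it as small as desired ([drift_coordinate_small]). The
    average is taken over M equally spaced points, which avoids parameter integrals
    at the price of one more error term.

    All this needs the derivatives of f to be O(eps), with a Taylor remainder
    eps O(|w|^2), uniformly in f ([perturbation_jet]). These bounds are Cauchy
    estimates on complex lines. Only pointwise complex differentiability is given,
    so they are derived from Goursat's bisection argument ([goursat_rectangle]),
    applied in logarithmic coordinates, where circles around a point become vertical
    periods ([cauchy_estimate_Re]). *)

Set Implicit Arguments.
Unset Strict Implicit.
Unset Printing Implicit Defensive.

Import Order.TTheory GRing.Theory Num.Theory.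
Import numFieldNormedType.Exports.

Local Open Scope classical_set_scope.
Local Open Scope ring_scope.

(** * Difference quotients and complex norms *)

Lemma is_derive_normP (K : numFieldType) (W : normedModType K) (g : K -> W)
    (x : K) (a : W) :
  is_derive x (1 : K) g a <->
  forall e : K, 0 < e -> exists2 d : K, 0 < d &
    forall h : K, `|h| < d -> `|g (x + h) - g x - h *: a| <= e * `|h|.
Proof.
split=> [[dg <-] e e0|H].
  have /derivable_nbhs/eqaddoP dF := dg.
  have /dF/nbhs_ballP[d /= d0 Hd] := e0; exists d => // h hd.
  have /Hd : ball (0 : K) d h by rewrite -ball_normE /= sub0r normrN.
  have -> : ((fun h => (g \o shift x) (h *: (1 : K))) -
      (cst (g x) + (fun h => h *: 'D_1 g x))) h =
      g (h *: (1 : K) + x) - (g x + h *: 'D_1 g x) by [].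
  by rewrite opprD addrA [h *: (1 : K)]mulr1 [h + x]addrC.
have cv : (fun h => h^-1 *: ((g \o shift x) (h *: (1 : K)) - g x)) @ 0^' --> a.
  apply/cvgrPdist_le => e e_gt0; have [d d0 Hd] := H _ e_gt0.
  rewrite /= near_withinE; apply/nbhs_ballP; exists d => // h.
  rewrite -ball_normE /= sub0r normrN => /Hd Hh h0.
  have -> : a - h^-1 *: ((g \o shift x) (h *: (1 : K)) - g x) =
      - (h^-1 *: (g (x + h) - g x - h *: a)).
    rewrite [in RHS]scalerBr scalerA mulVf // scale1r opprB /=.
    by rewrite [h *: (1 : K)]mulr1 [h + x]addrC.
  by rewrite normrN normrZ normfV ler_pdivrMl ?normr_gt0 // mulrC.
apply: DeriveDef; first by apply/cvg_ex; exists a.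
exact/cvg_lim.
Qed.

Lemma is_derive_shift (K : numFieldType) (W : normedModType K) (g : K -> W)
    (x c : K) (a : W) :
  is_derive (x + c) (1 : K) g a -> is_derive x (1 : K) (fun y => g (y + c)) a.
Proof.
move=> /is_derive_normP H; apply/is_derive_normP => e /H[d d0 Hd].
by exists d => // h /Hd; rewrite [x + c + h]addrAC.
Qed.

Section ComplexNorm.
Variable R : realType.
Local Notation C := (Cplx R).

Lemma rnormE (V : normedModType C) (v : V) : `|v| = (rnorm v)%:C%C.
Proof.
have := normr_ge0 v; rewrite /rnorm; case: (`|v|) => a b /=.
by rewrite lecE /= => /andP[/eqP -> _].
Qed.

Lemma rnorm_ge0 (V : normedModType C) (v : V) : 0 <= rnorm v.
Proof. rewrite -lecR -rnormE; exact: normr_ge0. Qed.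

Lemma rnormD (V : normedModType C) (v w : V) :
  rnorm (v + w) <= rnorm v + rnorm w.
Proof. by rewrite -lecR rmorphD /= -!rnormE ler_normD. Qed.

Lemma rnormZ (V : normedModType C) (a : C) (v : V) :
  rnorm (a *: v) = rnorm a * rnorm v.
Proof. have := normrZ a v; rewrite !rnormE -rmorphM; by case. Qed.

Lemma rnormM (a b : C) : rnorm (a * b) = rnorm a * rnorm b.
Proof. exact: (rnormZ a (b : C^o)). Qed.

Lemma rnormN (V : normedModType C) (v : V) : rnorm (- v) = rnorm v.
Proof. by rewrite /rnorm normrN. Qed.

Lemma rnorm0 (V : normedModType C) : rnorm (0 : V) = 0.
Proof. by rewrite /rnorm normr0. Qed.

Lemma rnormB (V : normedModType C) (v w : V) :
  rnorm (v - w) <= rnorm v + rnorm w.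
Proof. by rewrite -(rnormN w) rnormD. Qed.

Lemma rnormc (z : C) :
  rnorm z = Num.sqrt (complex.Re z ^+ 2 + complex.Im z ^+ 2).
Proof. by case: z. Qed.

Lemma rnorm_real (x : R) : rnorm (x%:C%C : C) = `|x|.
Proof. by rewrite rnormc /= expr0n addr0 sqrtr_sqr. Qed.

Lemma Re_le_rnorm (z : C) : `|complex.Re z| <= rnorm z.
Proof. by rewrite rnormc -sqrtr_sqr ler_wsqrtr // lerDl sqr_ge0. Qed.

Lemma Im_le_rnorm (z : C) : `|complex.Im z| <= rnorm z.
Proof. by rewrite rnormc -sqrtr_sqr ler_wsqrtr // lerDr sqr_ge0. Qed.

Lemma rnorm_le_ReIm (z : C) : rnorm z <= `|complex.Re z| + `|complex.Im z|.
Proof.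
rewrite rnormc -(ler_pXn2r (n := 2)) ?nnegrE ?sqrtr_ge0 ?addr_ge0 //.
rewrite sqr_sqrtr ?addr_ge0 ?sqr_ge0 // sqrrD !real_normK ?num_real //.
by rewrite lerD2r lerDl mulrn_wge0 // mulr_ge0.
Qed.

Lemma complex_gt0 (z : C) :
  0 < z -> 0 < complex.Re z /\ z = (complex.Re z)%:C%C.
Proof. by rewrite ltcE; case: z => p q /= /andP[/eqP ->]. Qed.

Lemma nbhs_rnorm (V : normedModType C) (P : set V) :
  nbhs (0 : V) P <->
  exists2 d : R, 0 < d & forall v, rnorm v < d -> P v.
Proof.
split.
  move=> /nbhs_ballP [d /= d0 H].
  exists (complex.Re d); first by move: d0; rewrite ltcE /= => /andP[].
  move=> v vd; apply: H; rewrite -ball_normE /= sub0r normrN rnormE.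
  move: d0; rewrite ltcE /= => /andP[/eqP d0 _].
  by rewrite ltcE /= d0 eqxx.
move=> [d d0 H]; apply/nbhs_ballP; exists d%:C%C; first by rewrite /= ltcR.
move=> v; rewrite -ball_normE /= sub0r normrN rnormE ltcR; exact: H.
Qed.

(** The norm of a complex normed space takes complex values; the estimates
    below need the differential bounded with real constants. *)
Lemma differentiable_rnorm (V W : normedModType C) (F : V -> W) (x : V) :
  differentiable F x -> forall e : R, 0 < e -> exists2 d : R, 0 < d &
    forall v, rnorm v < d -> rnorm (F (x + v) - F x - 'd F x v) <= e * rnorm v.
Proof.
move=> /diff_locally /eqaddoP dF e e0.
have /dF/nbhs_rnorm[d d0 H] : 0 < (e%:C%C : C) by rewrite ltcR.
exists d => // v /H /=.
rewrite !rnormE -rmorphM lecR.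
have -> : (F \o shift x - (cst (F x) + 'd F x)) v =
    F (v + x) - (F x + 'd F x v) by [].
by rewrite opprD addrA [v + x]addrC.
Qed.

Lemma is_derive_rnorm (W : normedModType C) (g : C -> W) (z : C) (a : W) :
  is_derive z (1 : C) g a <->
  forall e : R, 0 < e -> exists2 d : R, 0 < d &
    forall w : C, rnorm w < d ->
      rnorm (g (z + w) - g z - w *: a) <= e * rnorm w.
Proof.
split=> [/is_derive_normP dg e e0|H].
  have [|d d0 Hd] := dg e%:C%C; first by rewrite ltcR.
  have [d0' dE] := complex_gt0 d0.
  exists (complex.Re d) => // w wd.
  have := Hd w; rewrite !rnormE -rmorphM lecR; apply.
  by rewrite dE ltcR.
apply/is_derive_normP => e /complex_gt0[e0 ->].
have [d d0 Hd] := H _ e0; exists d%:C%C; first by rewrite ltcR.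
by move=> h; rewrite !rnormE -rmorphM ltcR lecR; apply: Hd.
Qed.

End ComplexNorm.

(** * Goursat theorem on rectangles *)

Section MeanValue.
Variable R : realType.
Implicit Types (f df : R -> R) (a b k : R).

(** Comparing the slope with an arbitrary constant m, rather than with 0, lets
    the affine part of a function be subtracted before it is estimated. *)
Lemma derive_affine_bound f df a b m k : a <= b ->
  (forall x, a <= x <= b -> is_derive x (1 : R) f (df x)) ->
  (forall x, a <= x <= b -> `|df x - m| <= k) ->
  `|f b - f a - m * (b - a)| <= k * (b - a).
Proof.
move=> ab fdf dfk.
have [||c cab ->] := @MVT_segment R f df a b ab.
- by move=> x; rewrite in_itv /= => /andP[ax xb]; apply: fdf; rewrite !ltW.
- apply: derivable_within_continuous => x; rewrite in_itv /= => xab.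
  by have := fdf x xab => -[].
rewrite -mulrBl normrM [X in _ * X]ger0_norm ?subr_ge0 //.
by rewrite ler_wpM2r ?subr_ge0 // dfk // -in_itv.
Qed.

Lemma derive_bound f df a b k :
  (forall x, Num.min a b <= x <= Num.max a b -> is_derive x (1 : R) f (df x)) ->
  (forall x, Num.min a b <= x <= Num.max a b -> `|df x| <= k) ->
  `|f b - f a| <= k * `|b - a|.
Proof.
wlog ab : a b / a <= b => [H|].
  move=> fdf dfk; case: (leP a b) => [/H|/ltW /H]; first exact.
  by rewrite distrC (distrC b); apply; rewrite minC maxC.
rewrite min_l // max_r // => fdf dfk.
have := @derive_affine_bound f df a b 0 k ab fdf.
rewrite mul0r subr0 [`|b - a|]ger0_norm ?subr_ge0 //; apply=> // x xab.
by rewrite subr0 dfk.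
Qed.

End MeanValue.

Section Primitive.
Variable R : realType.

(** Continuity on a closed interval is asked, so that the integral from its left
    end exists, and the derivative is only obtained inside the interval. *)
Lemma primitive_exists (u : R -> R) (a b : R) :
  (forall x, a <= x <= b -> {for x, continuous u}) ->
  exists U : R -> R, forall x, a < x < b -> is_derive x (1 : R) U (u x).
Proof.
move=> uc.
exists (fun x => \int[@lebesgue_measure R]_(t in [set` `[a, x]]) u t)%R.
move=> x /andP[ax xb].
have uI : (@lebesgue_measure R).-integrable `[a, b] (EFin \o u).
  apply: continuous_compact_integrable; first exact: segment_compact.
  apply: continuous_in_subspaceT => y; rewrite inE /= in_itv /=; exact: uc.
have ux : {for x, continuous u} by apply: uc; rewrite !ltW.
have [dU dUE] := @continuous_FTC1_closed R u a x b xb uI ax ux.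
by apply: (DeriveDef dU); exact: (etrans (esym (derive1E _ _)) dUE).
Qed.

End Primitive.

Section Nested.
Variable R : realType.

Lemma nested_intervals (s l : nat -> R) :
  (forall k, s k <= s k.+1) -> (forall k, s k.+1 + l k.+1 <= s k + l k) ->
  (forall k, 0 <= l k) ->
  exists x, forall k, s k <= x <= s k + l k.
Proof.
move=> sS slS l0.
have s_mono : {homo s : i j / (i <= j)%N >-> i <= j}.
  by apply: homo_leq => //; apply: le_trans.
have sl_mono : {homo (fun k => s k + l k) : i j / (i <= j)%N >-> j <= i}.
  by apply: homo_leq => // i j k ji kj; apply: le_trans kj ji.
have ub k : ubound (range s) (s k + l k).
  move=> _ [j _ <-]; have [jk|/ltnW kj] := leqP j k.
    by rewrite (le_trans (s_mono _ _ jk)) // lerDl.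
  by rewrite (le_trans _ (sl_mono _ _ kj)) //= lerDl.
exists (sup (range s)) => k; apply/andP; split.
  by apply: ub_le_sup; [exists (s 0%N + l 0%N); exact: ub | exists k].
by apply: ge_sup; [exists (s 0%N), 0%N | exact: ub].
Qed.

End Nested.

Section Goursat.
Variable R : realType.
Implicit Types (P Q PP QQ : R -> R -> R) (x y a b c d e : R).

(** The integral of the form P dx + Q dy along the boundary of the rectangle
    [a, b] x [c, d], written with primitives: PP y of x |-> P x y, and QQ x of
    y |-> Q x y. Additivity under subdivision is then a ring identity, and
    bounds follow from the mean value theorem, with no integral at all. *)
Definition circulation PP QQ a b c d :=
  (PP c b - PP c a) + (QQ b d - QQ b c)
    - (PP d b - PP d a) - (QQ a d - QQ a c).

(** The circulation of an affine form with equal cross derivatives be vanishes,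
    so only the error e of the affine approximation contributes, once for each
    pair of opposite sides. *)
Lemma circulation_affine P Q PP QQ a b c d x0 y0 al be ga e :
  a <= b -> c <= d -> a <= x0 <= b -> c <= y0 <= d ->
  (forall x y, a <= x <= b -> c <= y <= d ->
    is_derive x (1 : R) (PP y) (P x y) /\ is_derive y (1 : R) (QQ x) (Q x y)) ->
  (forall x y, a <= x <= b -> c <= y <= d ->
    `|P x y - P x0 y0 - (al * (x - x0) + be * (y - y0))| <= e /\
    `|Q x y - Q x0 y0 - (be * (x - x0) + ga * (y - y0))| <= e) ->
  `|circulation PP QQ a b c d| <= (e + e) * (b - a + (d - c)).
Proof.
move=> ab cd x0ab y0cd dPQ appr.
have Ib : a <= b <= b by rewrite ab lexx.
have Ia : a <= a <= b by rewrite ab lexx.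
have Id : c <= d <= d by rewrite cd lexx.
have Ic : c <= c <= d by rewrite cd lexx.
have HP : `|(PP c - PP d) b - (PP c - PP d) a - be * (c - d) * (b - a)|
    <= (e + e) * (b - a).
  apply: (@derive_affine_bound R _ (fun x => P x c - P x d)) => // x xab.
    have [? _] := dPQ x c xab Ic; have [? _] := dPQ x d xab Id.
    exact: is_deriveB.
  have [+ _] := appr x c xab Ic; have [+ _] := appr x d xab Id.
  by rewrite !ler_norml => /andP[? ?] /andP[? ?]; apply/andP; split; lra.
have HQ : `|(QQ b - QQ a) d - (QQ b - QQ a) c - be * (b - a) * (d - c)|
    <= (e + e) * (d - c).
  apply: (@derive_affine_bound R _ (fun y => Q b y - Q a y)) => // y ycd.
    have [_ ?] := dPQ b y Ib ycd; have [_ ?] := dPQ a y Ia ycd.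
    exact: is_deriveB.
  have [_ +] := appr b y Ib ycd; have [_ +] := appr a y Ia ycd.
  by rewrite !ler_norml => /andP[? ?] /andP[? ?]; apply/andP; split; lra.
have -> : circulation PP QQ a b c d =
    ((PP c - PP d) b - (PP c - PP d) a - be * (c - d) * (b - a)) +
    ((QQ b - QQ a) d - (QQ b - QQ a) c - be * (b - a) * (d - c)).
  rewrite /circulation -![(_ - _ : R -> R) _]/(_ - _); ring.
by rewrite [leRHS]mulrDr; apply: le_trans (ler_normD _ _) _; exact: lerD.
Qed.

Lemma circulation_split PP QQ a m b c p d :
  circulation PP QQ a b c d =
    circulation PP QQ a m c p + circulation PP QQ m b c p
    + circulation PP QQ a m p d + circulation PP QQ m b p d.
Proof. by rewrite /circulation; ring. Qed.

Lemma pigeonhole4 (w1 w2 w3 w4 : R) (w : R) : w <= `|w1 + w2 + w3 + w4| ->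
  [\/ w / 4 <= `|w1|, w / 4 <= `|w2|, w / 4 <= `|w3| | w / 4 <= `|w4|].
Proof.
move=> H; have := le_trans H (ler_normD _ _).
have := ler_normD (w1 + w2) w3; have := ler_normD w1 w2.
case: (lerP (w / 4) `|w1|); first by constructor 1.
case: (lerP (w / 4) `|w2|); first by constructor 2.
case: (lerP (w / 4) `|w3|); first by constructor 3.
case: (lerP (w / 4) `|w4|); first by constructor 4.
by move=> *; exfalso; lra.
Qed.

(** Goursat's bisection: a nonzero circulation forces one of the four quarter
    rectangles to carry at least a quarter of it. The nested rectangles obtained
    in this way shrink to a point where the form is differentiable, and there
    circulation_affine bounds the circulation by an arbitrarily small
    multiple of the square of the size. No continuity of the derivatives is required, which is what
    pointwise complex differentiability provides. *)
Lemma goursat_rectangle P Q PP QQ a b c d : a <= b -> c <= d ->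
  (forall x y, a <= x <= b -> c <= y <= d ->
    is_derive x (1 : R) (PP y) (P x y) /\ is_derive y (1 : R) (QQ x) (Q x y)) ->
  (forall x0 y0, a <= x0 <= b -> c <= y0 <= d -> exists al be ga, forall e,
    0 < e -> exists2 dl, 0 < dl & forall x y, a <= x <= b -> c <= y <= d ->
      `|x - x0| + `|y - y0| < dl ->
    `|P x y - P x0 y0 - (al * (x - x0) + be * (y - y0))|
       <= e * (`|x - x0| + `|y - y0|) /\
    `|Q x y - Q x0 y0 - (be * (x - x0) + ga * (y - y0))|
       <= e * (`|x - x0| + `|y - y0|)) ->
  circulation PP QQ a b c d = 0.
Proof.
move=> ab cd dPQ appr; apply/eqP; rewrite -normr_eq0; apply/negPn/negP => W0.
pose K := `|circulation PP QQ a b c d|.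
have K0 : 0 < K by rewrite lt_def W0 normr_ge0.
pose h k (t : R) : R := t / 2 ^+ k.
have hS k t : h k t = h k.+1 t + h k.+1 t by rewrite /h exprS; field.
have h_ge0 k t : 0 <= t -> 0 <= h k t.
  by move=> t0; rewrite divr_ge0 // exprn_ge0.
pose W k (p : R * R) :=
  circulation PP QQ p.1 (p.1 + h k (b - a)) p.2 (p.2 + h k (d - c)).
have step k p : exists q : R * R, (K / 4 ^+ k <= `|W k p| ->
    K / 4 ^+ k.+1 <= `|W k.+1 q|) /\
  (q.1 = p.1 \/ q.1 = p.1 + h k.+1 (b - a)) /\
  (q.2 = p.2 \/ q.2 = p.2 + h k.+1 (d - c)).
  have [H|] := lerP (K / 4 ^+ k) `|W k p|; last first.
    by move=> H; exists p; split => //; split; left.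
  move: H; rewrite /W (circulation_split PP QQ p.1 (p.1 + h k.+1 (b - a)) _
    p.2 (p.2 + h k.+1 (d - c))).
  have -> : p.1 + h k (b - a) = p.1 + h k.+1 (b - a) + h k.+1 (b - a).
    by rewrite hS addrA.
  have -> : p.2 + h k (d - c) = p.2 + h k.+1 (d - c) + h k.+1 (d - c).
    by rewrite hS addrA.
  have E : K / 4 ^+ k / 4 = K / 4 ^+ k.+1 by rewrite exprS; field.
  move=> /pigeonhole4; rewrite E => -[] H.
  - by exists p; split=> //; split; left.
  - by exists (p.1 + h k.+1 (b - a), p.2); split=> //; split; [right|left].
  - by exists (p.1, p.2 + h k.+1 (d - c)); split=> //; split; [left|right].
  - by exists (p.1 + h k.+1 (b - a), p.2 + h k.+1 (d - c)); split=> //; split; right.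
pose nxt k p := projT1 (cid (step k p)).
pose s := fix s k := if k is k'.+1 then nxt k' (s k') else (a, c).
have sS k : [/\ K / 4 ^+ k <= `|W k (s k)| ->
    K / 4 ^+ k.+1 <= `|W k.+1 (s k.+1)|,
    (s k.+1).1 = (s k).1 \/ (s k.+1).1 = (s k).1 + h k.+1 (b - a) &
    (s k.+1).2 = (s k).2 \/ (s k.+1).2 = (s k).2 + h k.+1 (d - c)].
  by rewrite /= /nxt; case: cid => q /= [? []].
have Wk k : K / 4 ^+ k <= `|W k (s k)|.
  elim: k => [|k IH]; last by case: (sS k) => /(_ IH).
  by rewrite /W /h expr0 !divr1 /= [a + _]addrC [c + _]addrC !subrK.
have ba0 : 0 <= b - a by rewrite subr_ge0.
have dc0 : 0 <= d - c by rewrite subr_ge0.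
have [x0 Hx0] : exists x, forall k, (s k).1 <= x <= (s k).1 + h k (b - a).
  apply: nested_intervals => k; last exact: h_ge0.
    by case: (sS k) => _ [] -> _ //; rewrite lerDl h_ge0.
  have := h_ge0 k.+1 _ ba0; rewrite (hS k).
  by case: (sS k) => _ [] -> _ u0; clear - u0; lra.
have [y0 Hy0] : exists y, forall k, (s k).2 <= y <= (s k).2 + h k (d - c).
  apply: nested_intervals => k; last exact: h_ge0.
    by case: (sS k) => _ _ [] ->  //; rewrite lerDl h_ge0.
  have := h_ge0 k.+1 _ dc0; rewrite (hS k).
  by case: (sS k) => _ _ [] -> u0; clear - u0; lra.
have sin k : [/\ a <= (s k).1, (s k).1 + h k (b - a) <= b, c <= (s k).2
    & (s k).2 + h k (d - c) <= d].
  elim: k => [|k [IH1 IH2 IH3 IH4]].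
    by rewrite /h expr0 !divr1 /= ![_ + (_ - _)]addrC !subrK.
  have u0 := h_ge0 k.+1 _ ba0; have v0 := h_ge0 k.+1 _ dc0.
  move: IH2 IH4; rewrite !(hS k) => IH2 IH4.
  case: (sS k) => _ e1 e2; clear - e1 e2 IH1 IH2 IH3 IH4 u0 v0.
  by split; [case: e1|case: e1|case: e2|case: e2] => ->; lra.
have x0ab : a <= x0 <= b.
  have [i1 i2 _ _] := sin 0%N; have /andP[i3 i4] := Hx0 0%N.
  by rewrite (le_trans i1 i3) (le_trans i4 i2).
have y0cd : c <= y0 <= d.
  have [_ _ i1 i2] := sin 0%N; have /andP[i3 i4] := Hy0 0%N.
  by rewrite (le_trans i1 i3) (le_trans i4 i2).
have [al [be [ga H]]] := appr x0 y0 x0ab y0cd.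
pose S := b - a + (d - c).
have S0 : 0 <= S by rewrite addr_ge0.
(* After k steps the circulation is at least K / 4^k and at most 2 e S^2 / 4^k;
   this e makes the two incompatible, also when S = 0. *)
have e0 : 0 < K / (4 * (S ^+ 2 + 1)).
  by rewrite divr_gt0 // mulr_gt0 // ltr_wpDl ?sqr_ge0.
have [dl dl0 Hdl] := H _ e0.
set e := K / _ in e0 Hdl.
have [k Hk] : exists k, h k S < dl.
  have [k Hk] : exists k, S / dl < 2 ^+ k.
    exists (Num.truncn (S / dl)).+1.
    have S1 : S / dl < (Num.truncn (S / dl)).+1%:R by rewrite truncnS_gt.
    rewrite (lt_trans S1) // -natrX ltr_nat ltn_expl //.
  exists k; rewrite /h ltr_pdivrMr ?exprn_gt0 // mulrC -ltr_pdivrMr //.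
have [s1 s2 s3 s4] := sin k.
have hD : h k S = h k (b - a) + h k (d - c) by rewrite /h mulrDl.
have := Wk k; rewrite leNgt => /negP; apply.
have near : forall x y, (s k).1 <= x <= (s k).1 + h k (b - a) ->
    (s k).2 <= y <= (s k).2 + h k (d - c) -> `|x - x0| + `|y - y0| <= h k S.
  move=> x y xk yk; rewrite hD lerD // ler_norml.
    by have x0k := Hx0 k; clear - xk x0k; lra.
  by have y0k := Hy0 k; clear - yk y0k; lra.
have xsub x : (s k).1 <= x <= (s k).1 + h k (b - a) -> a <= x <= b.
  by move=> /andP[xk1 xk2]; rewrite (le_trans s1 xk1) (le_trans xk2 s2).
have ysub y : (s k).2 <= y <= (s k).2 + h k (d - c) -> c <= y <= d.
  by move=> /andP[yk1 yk2]; rewrite (le_trans s3 yk1) (le_trans yk2 s4).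
apply: (@le_lt_trans _ _ ((e * h k S + e * h k S) * h k S)).
  apply: le_trans (@circulation_affine P Q PP QQ _ _ _ _ x0 y0 al be ga
    (e * h k S) _ _ _ _ _ _) _ => //.
  - by rewrite lerDl h_ge0.
  - by rewrite lerDl h_ge0.
  - by move=> x y /xsub xab /ysub ycd; apply: dPQ.
  - move=> x y xk yk; have hn := near x y xk yk.
    have [h1 h2] := Hdl x y (xsub x xk) (ysub y yk) (le_lt_trans hn Hk).
    have he : e * (`|x - x0| + `|y - y0|) <= e * h k S by rewrite ler_pM2l.
    by split; [apply: le_trans h1 he|apply: le_trans h2 he].
  - by rewrite hD ![_ + h k _ - _]addrAC !subrr !add0r.
have -> : (e * h k S + e * h k S) * h k S = 2 * e * S ^+ 2 / 4 ^+ k.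
  have -> : (4 : R) ^+ k = 2 ^+ k ^+ 2.
    by rewrite -exprM mulnC exprM; congr (_ ^+ k); ring.
  rewrite /h; field.
  by rewrite expf_neq0.
rewrite ltr_pM2r ?invr_gt0 ?exprn_gt0 //.
rewrite /e; have : 0 < S ^+ 2 + 1 by rewrite ltr_wpDl ?sqr_ge0.
set T := S ^+ 2 => T0.
have -> : 2 * (K / (4 * (T + 1))) * T = K * (T / (2 * (T + 1))).
  by field; clear - T0; lra.
by rewrite gtr_pMr // ltr_pdivrMr; clear - T0; lra.
Qed.

End Goursat.

(** * Complex exponential and Cauchy estimates *)

Section RealEps.
Variable R : realType.

Lemma expR_sub1_small (e : R) : 0 < e -> exists2 d : R, 0 < d &
  forall x, `|x| < d -> `|expR x - 1 - x| <= e * `|x|.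
Proof.
move=> e0.
have /is_derive_normP H : is_derive (0 : R) (1 : R) expR (expR 0).
  exact: is_derive_expR.
have [d d0 Hd] := H e e0; exists d => // x /Hd.
by rewrite add0r expR0 [x *: _]mulr1.
Qed.

Lemma sin_small (e : R) : 0 < e -> exists2 d : R, 0 < d &
  forall x, `|x| < d -> `|sin x - x| <= e * `|x|.
Proof.
move=> e0.
have /is_derive_normP H : is_derive (0 : R) (1 : R) sin (cos 0).
  exact: is_derive_sin.
have [d d0 Hd] := H e e0; exists d => // x /Hd.
by rewrite add0r sin0 cos0 subr0 [x *: _]mulr1.
Qed.

Lemma cos_small (e : R) : 0 < e -> exists2 d : R, 0 < d &
  forall x, `|x| < d -> `|cos x - 1| <= e * `|x|.
Proof.
move=> e0.
have /is_derive_normP H : is_derive (0 : R) (1 : R) cos (- sin 0).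
  exact: is_derive_cos.
have [d d0 Hd] := H e e0; exists d => // x /Hd.
by rewrite add0r sin0 cos0 oppr0 scaler0 subr0.
Qed.

End RealEps.

Section ComplexExp.
Variable R : realType.
Local Notation C := (Cplx R).

Definition cexp (z : C) : C :=
  Complex (expR (complex.Re z) * cos (complex.Im z))
          (expR (complex.Re z) * sin (complex.Im z)).

Lemma ReD (z w : C) : complex.Re (z + w) = complex.Re z + complex.Re w.
Proof. by case: z w => ? ? []. Qed.
Lemma ImD (z w : C) : complex.Im (z + w) = complex.Im z + complex.Im w.
Proof. by case: z w => ? ? []. Qed.
Lemma ReN (z : C) : complex.Re (- z) = - complex.Re z.
Proof. by case: z. Qed.
Lemma ImN (z : C) : complex.Im (- z) = - complex.Im z.
Proof. by case: z. Qed.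
Lemma ReM (z w : C) : complex.Re (z * w) =
  complex.Re z * complex.Re w - complex.Im z * complex.Im w.
Proof. by case: z w => ? ? []. Qed.
Lemma ImM (z w : C) : complex.Im (z * w) =
  complex.Re z * complex.Im w + complex.Im z * complex.Re w.
Proof. by case: z w => ? ? []. Qed.

Lemma ReIm_eq (z w : C) : complex.Re z = complex.Re w ->
  complex.Im z = complex.Im w -> z = w.
Proof. by case: z w => ? ? [? ?] /= -> ->. Qed.

Lemma cexpD (z w : C) : cexp (z + w) = cexp z * cexp w.
Proof.
by apply: ReIm_eq; rewrite ?ReM ?ImM /= !ReD !ImD expRD ?cosD ?sinD; ring.
Qed.

Lemma cexp0 : cexp 0 = 1.
Proof.
by apply: ReIm_eq; rewrite /= expR0 ?cos0 ?sin0 ?mulr1 ?mulr0.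
Qed.

Lemma cexpNK (z : C) : cexp z * cexp (- z) = 1.
Proof. by rewrite -cexpD subrr cexp0. Qed.

Lemma rnorm_cexp (z : C) : rnorm (cexp z) = expR (complex.Re z).
Proof.
rewrite rnormc /= !exprMn -mulrDr cos2Dsin2 mulr1 sqrtr_sqr ger0_norm //.
Qed.

Lemma cexp_periodic (z : C) : cexp (z + Complex 0 (pi *+ 2)) = cexp z.
Proof.
by rewrite cexpD; apply: ReIm_eq; rewrite ?ReM ?ImM /=  expR0 cos2pi sin2pi; ring.
Qed.

(** By the functional equation only the expansion at 0 matters, and it reduces
    to the first-order expansions of exp, cos and sin at 0. *)
Lemma is_derive_cexp (z : C) : is_derive z (1 : C) cexp (cexp z).
Proof.
apply/is_derive_rnorm => e e0.
pose M := expR (complex.Re z) + 1.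
have M0 : 0 < M by rewrite ltr_wpDl // expR_ge0.
have [k [k0 k1 kM]] : exists k : R, [/\ 0 < k, k <= 1 & M * (10 * k) <= e].
  exists (Num.min (e / (10 * M)) 1); split.
  - by rewrite lt_min ltr01 divr_gt0 // mulr_gt0.
  - by rewrite ge_min lexx orbT.
  - rewrite mulrA [M * 10]mulrC -ler_pdivlMl ?mulr_gt0 // [_^-1 * _]mulrC.
    by rewrite ge_min lexx.
have [d1 d10 H1] := expR_sub1_small k0.
have [d2 d20 H2] := sin_small k0.
have [d3 d30 H3] := cos_small k0.
exists (Num.min k (Num.min d1 (Num.min d2 d3))); first by rewrite !lt_min k0 d10 d20.
move=> w; rewrite !lt_min => /and4P[wk w1 w2 w3].
have -> : cexp (z + w) - cexp z - w *: cexp z = cexp z * (cexp w - 1 - w).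
  by rewrite cexpD [w *: _]mulrC; ring.
rewrite rnormM rnorm_cexp.
apply: (@le_trans _ _ (M * (10 * k * rnorm w))); last first.
  by rewrite mulrA ler_wpM2r ?rnorm_ge0.
apply: ler_pM; rewrite ?expR_ge0 ?rnorm_ge0 //; first by rewrite lerDl.
apply: le_trans (rnorm_le_ReIm _) _.
rewrite !ReD !ImD !ReN !ImN /=.
set x := complex.Re w; set y := complex.Im w; set r := rnorm w.
have xr : `|x| <= r := Re_le_rnorm w.
have yr : `|y| <= r := Im_le_rnorm w.
have E1 := H1 x (le_lt_trans xr w1).
have E2 := H2 y (le_lt_trans yr w2).
have E3 := H3 y (le_lt_trans yr w3).
have r0 : 0 <= r := rnorm_ge0 w.
have kr : 0 <= k * r by rewrite mulr_ge0 // ltW.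
have kkr : k * r * k <= k * r by rewrite ler_piMr.
have rk : r <= k := ltW wk.
have ub (u v : R) : `|u| <= r -> `|v| <= k * `|u| -> `|v| <= k * r.
  by move=> ur /le_trans; apply; rewrite ler_wpM2l // ltW.
have {}E1 := ub _ _ xr E1; have {}E2 := ub _ _ yr E2; have {}E3 := ub _ _ yr E3.
have -> : expR x * cos y - 1 - x =
   (expR x - 1 - x) * cos y + (cos y - 1) + x * (cos y - 1) by ring.
have -> : expR x * sin y - 0 - y = (expR x - 1 - x) * sin y + x * sin y + (sin y - y).
  by ring.
have k_le1 (v : R) : 0 <= v -> k * v <= v by move=> v0; rewrite ler_piMl.
have cosy : `|cos y| <= 1 by rewrite ler_norml cos_geN1 cos_le1.
have siny : `|sin y| <= 1 by rewrite ler_norml sin_geN1 sin_le1.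
have m1 (u v : R) : `|v| <= 1 -> `|u| <= k * r -> `|u * v| <= k * r.
  by move=> v1; apply: le_trans; rewrite normrM ler_piMr.
have x1 : `|x| <= 1 by rewrite (le_trans xr) // (le_trans rk).
have A1 : `|x * (cos y - 1)| <= k * r by rewrite mulrC; apply: m1.
have A2 : `|x * sin y| <= 2 * (k * r).
  have sy2 : `|sin y| <= 2 * r.
    have -> : sin y = (sin y - y) + y by ring.
    apply: le_trans (ler_normD _ _) _.
    by have := k_le1 _ r0; clear - E2 yr; lra.
  rewrite normrM; apply: le_trans (ler_pM _ _ (le_trans xr rk) sy2) _ => //.
  by rewrite mulrCA.
have B1 := m1 _ _ cosy E1; have B2 := m1 _ _ siny E1.
have T1 := ler_normD ((expR x - 1 - x) * cos y + (cos y - 1)) (x * (cos y - 1)).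
have T2 := ler_normD ((expR x - 1 - x) * cos y) (cos y - 1).
have T3 := ler_normD ((expR x - 1 - x) * sin y + x * sin y) (sin y - y).
have T4 := ler_normD ((expR x - 1 - x) * sin y) (x * sin y).
have kr0 : 0 <= k * r by rewrite mulr_ge0 // ltW.
rewrite -mulrA; clear - A1 A2 B1 B2 E2 E3 T1 T2 T3 T4 kr0; lra.
Qed.

End ComplexExp.

Section CauchyEstimate.
Variable R : realType.
Local Notation C := (Cplx R).
Implicit Types (G g : C -> C) (z w : C).

(** The Cauchy-Riemann equations: for G dz = (Re G + i Im G)(dx + i dy), the
    imaginary part is Im G dx + Re G dy, and its two cross derivatives are both
    Re a. *)
Lemma holomorphic_real_parts G z a : is_derive z (1 : C) G a ->
  forall e : R, 0 < e -> exists2 d : R, 0 < d & forall w : C, rnorm w < d ->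
    `|complex.Im (G (z + w)) - complex.Im (G z) -
      (complex.Im a * complex.Re w + complex.Re a * complex.Im w)|
      <= e * rnorm w /\
    `|complex.Re (G (z + w)) - complex.Re (G z) -
      (complex.Re a * complex.Re w + - complex.Im a * complex.Im w)|
      <= e * rnorm w.
Proof.
move=> /is_derive_rnorm H e e0; have [d d0 Hd] := H e e0.
exists d => // w /Hd Hw; split; apply: le_trans Hw.
  apply: le_trans (Im_le_rnorm _); rewrite !ImD !ImN ImM.
  by rewrite le_eqVlt; apply/orP; left; apply/eqP; congr (`|_|); ring.
apply: le_trans (Re_le_rnorm _); rewrite !ReD !ReN ReM.
by rewrite le_eqVlt; apply/orP; left; apply/eqP; congr (`|_|); ring.
Qed.

(** In the rectangle [x1, x2] x [0, T] the horizontal sides cancel by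
    periodicity, so the mean of Re G over a vertical period is the same at x1
    and at x2. It is close to m on the first side and bounded by M on the second. *)
Lemma periodic_strip_estimate G (x1 x2 X T M m e : R) :
  x1 <= x2 -> x2 < X -> 0 < T ->
  (forall z, complex.Re z < X -> derivable G z (1 : C)) ->
  (forall z, complex.Re z < X -> G (z + Complex 0 T) = G z) ->
  (forall y, `|complex.Re (G (Complex x2 y))| <= M) ->
  (forall y, `|complex.Re (G (Complex x1 y)) - m| <= e) ->
  `|m| <= M + e.
Proof.
move=> x12 x2X T0 dG GT GM Gm.
pose P (x y : R) := complex.Im (G (Complex x y)).
pose Q (x y : R) := complex.Re (G (Complex x y)).
have approx x0 y0 : x0 < X -> exists al be ga, forall e', 0 < e' ->
    exists2 dl, 0 < dl & forall x y, `|x - x0| + `|y - y0| < dl ->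
    `|P x y - P x0 y0 - (al * (x - x0) + be * (y - y0))|
       <= e' * (`|x - x0| + `|y - y0|) /\
    `|Q x y - Q x0 y0 - (be * (x - x0) + ga * (y - y0))|
       <= e' * (`|x - x0| + `|y - y0|).
  move=> x0X; have dz := dG (Complex x0 y0) x0X.
  have /holomorphic_real_parts H := DeriveDef dz erefl.
  move: ('D_1 G _) H => a H.
  exists (complex.Im a), (complex.Re a), (- complex.Im a) => e' e'0.
  have [d d0 Hd] := H e' e'0; exists d => // x y xyd.
  have E : Complex x y = (Complex x0 y0 : C) + Complex (x - x0) (y - y0).
    by apply: ReIm_eq; rewrite ?ReD ?ImD /=; ring.
  have le1 := rnorm_le_ReIm (Complex (x - x0) (y - y0)).
  have [h1 h2] := Hd (Complex (x - x0) (y - y0)) (le_lt_trans le1 xyd).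
  rewrite /P /Q E; split; [apply: le_trans h1 _|apply: le_trans h2 _];
    by rewrite ler_wpM2l // ltW.
have cP x y : x < X -> {for x, continuous (fun x => P x y)}.
  move=> xX; have [al [be [ga H]]] := approx x y xX.
  suff : is_derive x (1 : R) (fun x => P x y) al.
    by case=> /derivable1_diffP/differentiable_continuous.
  apply/is_derive_normP => e' /H[d d0 Hd]; exists d => // h hd.
  have := Hd (x + h) y; rewrite subrr normr0 !mulr0 !addr0 [x + h - x]addrAC subrr add0r.
  by rewrite [h *: _]mulrC => /(_ hd)[].
have cQ x y : x < X -> {for y, continuous (Q x)}.
  move=> xX; have [al [be [ga H]]] := approx x y xX.
  suff : is_derive y (1 : R) (Q x) ga.
    by case=> /derivable1_diffP/differentiable_continuous.
  apply/is_derive_normP => e' /H[d d0 Hd]; exists d => // h hd.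
  have := Hd x (y + h); rewrite subrr normr0 !mulr0 !add0r [y + h - y]addrAC subrr add0r.
  by rewrite [h *: _]mulrC => /(_ hd)[].
have [PP dPP] : exists PP : R -> R -> R, forall x y, x1 <= x <= x2 ->
    is_derive x (1 : R) (PP y) (P x y).
  suff H y : exists U : R -> R, forall x, x1 <= x <= x2 ->
      is_derive x (1 : R) U (P x y).
    by exists (fun y => projT1 (cid (H y))) => x y; exact: (projT2 (cid (H y))).
  have [|U HU] := @primitive_exists R (fun x => P x y) (x1 - 1) ((x2 + X) / 2).
    by move=> x /andP[_ xX]; apply: cP; lra.
  by exists U => x x12'; apply: HU; lra.
have [QQ dQQ] : exists QQ : R -> R -> R, forall x y, x1 <= x <= x2 ->
    0 <= y <= T -> is_derive y (1 : R) (QQ x) (Q x y).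
  suff H x : exists U : R -> R, x1 <= x <= x2 -> forall y, 0 <= y <= T ->
      is_derive y (1 : R) U (Q x y).
    by exists (fun x => projT1 (cid (H x))) => x y xx; exact: (projT2 (cid (H x)) xx).
  have [xX|xX] := ltP x X; last by exists (fun=> 0); lra.
  have [|U HU] := @primitive_exists R (Q x) (- 1) (T + 1).
    by move=> y _; apply: cQ.
  by exists U => _ y y0T; apply: HU; lra.
have W0 : circulation PP QQ x1 x2 0 T = 0.
  apply: (@goursat_rectangle R P Q) => //; first exact: ltW.
    by move=> x y xx yy; split; [exact: dPP|exact: dQQ].
  move=> x0 y0 x0x y0y; have [|al [be [ga H]]] := approx x0 y0; first lra.
  exists al, be, ga => e' e'0; have [dl dl0 Hdl] := H e' e'0.
  by exists dl => // x y _ _; apply: Hdl.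
have P0T x : x1 <= x <= x2 -> P x 0 - P x T = 0.
  move=> xx; rewrite /P.
  have -> : Complex x T = (Complex x 0 : C) + Complex 0 T.
    by apply: ReIm_eq; rewrite ?ReD ?ImD /=; ring.
  by rewrite GT ?subrr //=; lra.
have horiz : PP 0 x2 - PP 0 x1 = PP T x2 - PP T x1.
  have : `|(PP 0 x2 - PP T x2) - (PP 0 x1 - PP T x1) - 0 * (x2 - x1)|
      <= 0 * (x2 - x1).
    apply: (derive_affine_bound (f := fun x => PP 0 x - PP T x)
      (df := fun x => P x 0 - P x T)) => // x xx.
      by apply: is_deriveB; apply: dPP.
    by rewrite P0T // subrr normr0.
  by rewrite !mul0r subr0 normr_le0 => /eqP; clear; lra.
have vert : QQ x2 T - QQ x2 0 = QQ x1 T - QQ x1 0.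
  by move: W0; rewrite /circulation horiz; clear; lra.
have B2 : `|QQ x2 T - QQ x2 0 - 0 * (T - 0)| <= M * (T - 0).
  apply: (derive_affine_bound (df := Q x2)); first exact: ltW.
    by move=> y yy; apply: dQQ => //; lra.
  by move=> y _; rewrite subr0; apply: GM.
have B1 : `|QQ x1 T - QQ x1 0 - m * (T - 0)| <= e * (T - 0).
  apply: (derive_affine_bound (df := Q x1)); first exact: ltW.
    by move=> y yy; apply: dQQ => //; lra.
  by move=> y _; apply: Gm.
have : `|m| * T <= (M + e) * T.
  rewrite -[X in `|m| * X](ger0_norm (ltW T0)) -normrM.
  move: B1 B2; rewrite vert mul0r !subr0 !ler_norml.
  by clear; lra.
by rewrite ler_pM2r.
Qed.

(** In logarithmic coordinates w = exp z, the function (g w - g 0) / w becomes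
    2 pi i-periodic on a half-plane and tends to g'(0) as Re z tends to -oo, so
    periodic_strip_estimate compares g'(0) with its values on a circle. *)
Lemma cauchy_estimate_Re g a (rho M : R) : 0 < rho ->
  (forall z, rnorm z < rho -> derivable g z (1 : C)) ->
  (forall z, rnorm z < rho -> rnorm (g z) <= M) ->
  is_derive (0 : C) (1 : C) g a -> `|complex.Re a| <= 4 * M / rho.
Proof.
move=> rho0 dg gM /is_derive_rnorm g0a.
have lnE x : x < ln rho -> expR x < rho.
  by move=> xr; rewrite -[ltRHS](lnK rho0) ltr_expR.
pose G z := (g (cexp z) - g 0) * cexp (- z).
have dG z : complex.Re z < ln rho -> derivable G z (1 : C).
  move=> /lnE zr.
  have [/derivable1_diffP dE _] := is_derive_cexp z.
  have [dN _] : is_derive z (1 : C) (fun z => cexp (- z)) (- cexp (- z)).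
    apply/is_derive_rnorm => e e0.
    have /is_derive_rnorm H := is_derive_cexp (- z).
    have [d d0 Hd] := H e e0; exists d => // w wd.
    by have := Hd (- w); rewrite rnormN -opprD scaleNr -scalerN; apply.
  have dgE : derivable (g \o @cexp R) z (1 : C).
    apply/derivable1_diffP; apply: differentiable_comp; first exact: dE.
    by apply/derivable1_diffP; apply: dg; rewrite rnorm_cexp.
  have dgEB : derivable (g \o @cexp R - cst (g 0)) z (1 : C).
    by apply: derivableB; [exact: dgE|exact: derivable_cst].
  exact: (derivableM dgEB dN).
have M0 : 0 <= M by apply: le_trans (rnorm_ge0 _) (gM 0 _); rewrite rnorm0.
apply/ler_addgt0Pr => e e0; have [d d0 Hd] := g0a e e0.
(* The radius rho / 2 stays strictly inside the disc; x1 corresponds to a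
   circle on which the difference quotient of g is within e of a. *)
pose x2 := ln (rho / 2); pose x1 := Num.min x2 (ln (d / 2)).
have r20 : 0 < rho / 2 by rewrite divr_gt0.
have d20 : 0 < d / 2 by rewrite divr_gt0.
have x2r : x2 < ln rho by rewrite ltr_ln ?posrE // ltr_pdivrMr //; lra.
have pi20 : (0 : R) < pi *+ 2 by rewrite mulrn_wgt0 // pi_gt0.
apply: (@periodic_strip_estimate G x1 x2 (ln rho) (pi *+ 2)) => //.
- by rewrite ge_min lexx.
- move=> z _; rewrite /G cexp_periodic opprD; congr (_ * _).
  by rewrite -[LHS]cexp_periodic subrK.
- move=> y; apply: le_trans (Re_le_rnorm _) _.
  rewrite /G rnormM rnorm_cexp ReN /= expRN lnK ?posrE // invf_div.
  have -> : 4 * M / rho = (M + M) * (2 / rho) by field; rewrite gt_eqF.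
  rewrite ler_wpM2r ?divr_ge0 ?(ltW rho0) //; apply: le_trans (rnormB _ _) _.
  by rewrite lerD // gM ?rnorm0 // rnorm_cexp lnE.
- move=> y; set z : C := Complex x1 y.
  have -> : complex.Re (G z) - complex.Re a = complex.Re (G z - a).
    by rewrite ReD ReN.
  apply: le_trans (Re_le_rnorm _) _.
  have -> : G z - a = (g (0 + cexp z) - g 0 - cexp z *: a) * cexp (- z).
    rewrite add0r mulrBl -scalerAl [a * _]mulrC scalerAl [cexp z *: _]cexpNK.
    by rewrite mul1r.
  rewrite rnormM rnorm_cexp ReN expRN ler_pdivrMr ?expR_gt0 //.
  rewrite -[expR (complex.Re z)]rnorm_cexp; apply: Hd.
  rewrite rnorm_cexp (@le_lt_trans _ _ (d / 2)) //.
    by rewrite -[leRHS](lnK d20) ler_expR /= ge_min lexx orbT.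
  by rewrite ltr_pdivrMr //; lra.
Qed.

(** Multiplying g by 1 and by i turns the bound on real parts into a bound on
    the modulus. *)
Lemma cauchy_estimate g z0 a (rho M : R) : 0 < rho ->
  (forall z, rnorm (z - z0) < rho -> derivable g z (1 : C)) ->
  (forall z, rnorm (z - z0) < rho -> rnorm (g z) <= M) ->
  is_derive z0 (1 : C) g a -> rnorm a <= 8 * M / rho.
Proof.
move=> rho0 dg gM /is_derive_rnorm ga.
have cauchy_c (c : C) : rnorm c = 1 ->
    `|complex.Re (c * a)| <= 4 * M / rho.
  move=> c1; apply: (@cauchy_estimate_Re (fun z => c * g (z0 + z))) => //.
  - move=> z zr.
    have [] : is_derive z (1 : C) (fun z => c * g (z0 + z))
        (c * 'D_1 g (z0 + z)); last by [].
    have dgz : derivable g (z0 + z) (1 : C) by apply: dg; rewrite addrC addKr.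
    apply/is_derive_rnorm => e e0.
    have /is_derive_rnorm H := DeriveDef dgz erefl.
    have [d d0 Hd] := H e e0; exists d => // w /Hd.
    by rewrite addrA -!mulrBr scalerAr -mulrBr rnormM c1 mul1r.
  - move=> z zr; rewrite rnormM c1 mul1r; apply: gM.
    by rewrite addrC addKr.
  - apply/is_derive_rnorm => e e0; have [d d0 Hd] := ga e e0.
    exists d => // w /Hd.
    by rewrite add0r addr0 scalerAr -!mulrBr rnormM c1 mul1r.
apply: le_trans (rnorm_le_ReIm _) _.
have h1 := cauchy_c 1 (etrans (rnorm_real 1) (normr1 _)).
have h2 : `|complex.Re ((Complex 0 1 : C) * a)| <= 4 * M / rho.
  by apply: cauchy_c; rewrite rnormc /= expr0n expr1n add0r sqrtr1.
move: h1 h2; rewrite mul1r ReM /= mul0r mul1r sub0r normrN.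
have -> : 8 * M / rho = 4 * M / rho + 4 * M / rho by ring.
by move=> h1 h2; apply: lerD.
Qed.

Lemma is_derive_real_line g z (t : R) a :
  is_derive (z + t%:C%C) (1 : C) g a ->
  is_derive t (1 : R) (fun s : R => complex.Re (g (z + s%:C%C))) (complex.Re a) /\
  is_derive t (1 : R) (fun s : R => complex.Im (g (z + s%:C%C))) (complex.Im a).
Proof.
move=> /holomorphic_real_parts H.
split; apply/is_derive_normP => e e0; have [d d0 Hd] := H e e0;
  exists d => // h hd; have := Hd h%:C%C; rewrite rnorm_real => /(_ hd) /=;
  rewrite !mulr0 !addr0 rmorphD /= addrA [h *: _]mulrC; by case.
Qed.

Lemma cauchy_increment g z (s rho M : R) : 0 < rho ->
  (forall w, rnorm w < rho -> derivable g w (1 : C)) ->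
  (forall w, rnorm w < rho -> rnorm (g w) <= M) ->
  rnorm z <= rho / 4 -> `|s| <= rho / 4 ->
  rnorm (g (z + s%:C%C) - g z) <= 32 * M / rho * `|s|.
Proof.
move=> rho0 dg gM zr sr.
have near (t : R) : Num.min 0 s <= t <= Num.max 0 s ->
    rnorm (z + t%:C%C) <= rho / 2.
  move=> ts; apply: le_trans (rnormD _ _) _; rewrite rnorm_real.
  have : `|t| <= `|s|.
    move: ts; case: (lerP 0 s) => s0 /andP[? ?].
      by rewrite !ger0_norm; lra.
    by rewrite !ler0_norm; lra.
  by clear - zr sr; lra.
have deriv (t : R) : Num.min 0 s <= t <= Num.max 0 s -> exists a,
    is_derive (z + t%:C%C) (1 : C) g a /\ rnorm a <= 16 * M / rho.
  move=> /near tr; exists ('D_1 g (z + t%:C%C)).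
  have dt : is_derive (z + t%:C%C) (1 : C) g ('D_1 g (z + t%:C%C)).
    by apply: DeriveDef => //; apply: dg; clear - tr rho0; lra.
  split=> //; have -> : 16 * M / rho = 8 * M / (rho / 2).
    by field; rewrite gt_eqF.
  have close w : rnorm (w - (z + t%:C%C)) < rho / 2 -> rnorm w < rho.
    move=> wr; rewrite -[w](subrK (z + t%:C%C)).
    by apply: le_lt_trans (rnormD _ _) _; clear - wr tr; lra.
  by apply: (@cauchy_estimate g (z + t%:C%C)) => //; [lra|..] =>
    w /close; [apply: dg|apply: gM].
have -> : 32 * M / rho * `|s| =
    16 * M / rho * `|s - 0| + 16 * M / rho * `|s - 0|.
  by rewrite subr0; ring.
apply: le_trans (rnorm_le_ReIm _) _.
rewrite !ReD !ReN !ImD !ImN -[in complex.Re (g z)](addr0 z) -[in complex.Im (g z)](addr0 z).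
apply: lerD.
  apply: (@derive_bound R (fun t : R => complex.Re (g (z + t%:C%C)))
    (fun t => complex.Re ('D_1 g (z + t%:C%C)))) => t /deriv[a [da aM]].
    have [_ ->] := da; exact: (is_derive_real_line da).1.
  have [_ ->] := da; exact: le_trans (Re_le_rnorm _) aM.
apply: (@derive_bound R (fun t : R => complex.Im (g (z + t%:C%C)))
  (fun t => complex.Im ('D_1 g (z + t%:C%C)))) => t /deriv[a [da aM]].
  have [_ ->] := da; exact: (is_derive_real_line da).2.
have [_ ->] := da; exact: le_trans (Im_le_rnorm _) aM.
Qed.

(** The increment z |-> g (z + t) - g z is itself holomorphic and, by
    cauchy_increment, of order t; Cauchy's estimate applied to it bounds
    g'(t) - g'(0) linearly in t. Thus a second-order bound is obtained from
    first derivatives only. *)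
Lemma cauchy_taylor g a (s rho M : R) : 0 < rho ->
  (forall w, rnorm w < rho -> derivable g w (1 : C)) ->
  (forall w, rnorm w < rho -> rnorm (g w) <= M) ->
  is_derive (0 : C) (1 : C) g a -> `|s| <= rho / 4 ->
  `|complex.Re (g s%:C%C) - complex.Re (g 0) - s * complex.Re a|
    <= 1024 * M / rho ^+ 2 * s ^+ 2.
Proof.
move=> rho0 dg gM g0a sr.
have M0 : 0 <= M by apply: le_trans (rnorm_ge0 _) (gM 0 _); rewrite rnorm0.
have small (t : R) : Num.min 0 s <= t <= Num.max 0 s -> `|t| <= `|s|.
  by case: (lerP 0 s) => s0 /andP[? ?]; [rewrite !ger0_norm|rewrite !ler0_norm]; lra.
have D (t : R) : `|t| <= `|s| -> is_derive (t%:C%C : C) (1 : C) g ('D_1 g (t%:C%C : C)).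
  move=> ts; apply: DeriveDef => //; apply: dg; rewrite rnorm_real.
  by clear - ts sr rho0; lra.
have dbound (t : R) : `|t| <= `|s| ->
    rnorm ('D_1 g (t%:C%C : C) - a) <= 1024 * M / rho ^+ 2 * `|s|.
  move=> ts.
  (* 32 M / rho |s| bounds the increment on the disc of radius rho / 4. *)
  have -> : 1024 * M / rho ^+ 2 * `|s| = 8 * (32 * M / rho * `|s|) / (rho / 4).
    by field; rewrite gt_eqF.
  apply: (@cauchy_estimate (fun z => g (z + t%:C%C) - g z) 0); first lra.
  - move=> z; rewrite subr0 => zr; apply: derivableB.
      have dz : derivable g (z + t%:C%C) (1 : C).
        apply: dg; apply: le_lt_trans (rnormD _ _) _; rewrite rnorm_real.
        by clear - zr ts sr rho0; lra.
      by have [] := is_derive_shift (DeriveDef dz erefl).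
    by apply: dg; clear - zr rho0; lra.
  - move=> z; rewrite subr0 => zr; apply: le_trans (cauchy_increment rho0 dg gM _ _) _.
    + exact: ltW.
    + exact: le_trans ts sr.
    + by rewrite ler_wpM2l // divr_ge0 ?mulr_ge0 // ltW.
  - apply: is_deriveB; apply: is_derive_shift; rewrite add0r; exact: D.
have -> : complex.Re (g s%:C%C) - complex.Re (g 0) - s * complex.Re a =
   (complex.Re (g (0 + s%:C%C)) - s * complex.Re a) - (complex.Re (g (0 + 0%:C%C)) - 0 * complex.Re a).
  by rewrite !add0r; ring.
have -> : 1024 * M / rho ^+ 2 * s ^+ 2 = 1024 * M / rho ^+ 2 * `|s| * `|s - 0|.
  by rewrite subr0 -[RHS]mulrA -expr2 real_normK ?num_real.
apply: (@derive_bound R (fun t : R => complex.Re (g (0 + t%:C%C)) - t * complex.Re a)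
  (fun t : R => complex.Re ('D_1 g (t%:C%C : C)) - complex.Re a)) => t /small ts.
  apply: is_deriveB.
    by apply: (is_derive_real_line _).1; rewrite add0r; exact: D.
  have H : is_derive t (1 : R) ( *%R^~ (complex.Re a)) (1 * complex.Re a).
    apply/is_derive_normP => e e0; exists 1 => // h _.
    rewrite (_ : _ - _ = 0) ?normr0 ?mulr_ge0 ?(ltW e0) //.
    by rewrite /GRing.scale /=; ring.
  by rewrite mul1r in H.
rewrite -ReN -ReD; apply: le_trans (Re_le_rnorm _) _; exact: dbound.
Qed.

End CauchyEstimate.

(** * Uniform Taylor expansion of analytic perturbations *)

Section RowNorm.
Variable n : nat.

Lemma row_norm_le (K : numDomainType) (v : 'rV[K]_n) (b : K) : 0 <= b ->
  (forall i, `|v 0 i| <= b) -> `|v| <= b.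
Proof.
move=> b0 vb; have vE : `|v| = mx_norm v by [].
have [v0|] := eqVneq `|v| 0; first by rewrite v0.
by rewrite vE => /mx_norm_neq0[[i j] ->]; rewrite ord1; apply: vb.
Qed.

Lemma row_norm_ge (R : realDomainType) (v : 'rV[R]_n) i : `|v 0 i| <= `|v|.
Proof.
by rewrite [`|v|]mx_normrE (le_bigmax _ (fun ij => `|v ij.1 ij.2|) (0, i)).
Qed.

Lemma prod_norm_le (R : numFieldType) (V W : normedModType R) (w : V * W) (b : R) :
  `|w.1| <= b -> `|w.2| <= b -> `|w| <= b.
Proof.
move=> w1 w2; rewrite prod_normE comparable_ge_max ?w1 //.
by apply: real_comparable; exact: normr_real.
Qed.

End RowNorm.

Section Slices.
Variables (R : realType) (n : nat).
Local Notation C := (Cplx R).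
Implicit Types (w : 'rV[R]_n * 'rV[R]_n).

Definition toC2 w : 'rV[C]_n * 'rV[C]_n := (toC w.1, toC w.2).

Lemma rnorm_toC (v : 'rV[R]_n) : rnorm (toC v) <= `|v|.
Proof.
rewrite -lecR -rnormE; apply: row_norm_le => [|i]; first by rewrite lecR.
rewrite mxE; apply: (@le_trans _ _ (`|v 0 i|%:C%C : C)).
  by rewrite -rnorm_real -rnormE.
by rewrite lecR row_norm_ge.
Qed.

(** Complex lines through a real point in a real direction stay in the complex
    neighbourhood as long as the displacement is smaller than sigma. *)
Lemma slice_in_nbhd (B : set 'rV[R]_n) (sigma : R) (th I : 'rV[R]_n) w (z : C) :
  B I -> rnorm z * `|w| < sigma ->
  complex_nbhd B sigma (toC2 (th, I) + z *: toC2 w).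
Proof.
move=> BI zw; split.
  apply: le_lt_trans zw; apply: row_norm_le => [|i].
    by rewrite mulr_ge0 ?rnorm_ge0.
  rewrite !mxE ImD ImM /= mulr0 !add0r normrM.
  rewrite ler_pM ?Im_le_rnorm //; apply: le_trans (row_norm_ge _ _) _.
  by rewrite prod_normE le_max lexx.
apply: le_lt_trans zw; rewrite /complex_dist.
apply: (@le_trans _ _ (rnorm (z *: toC w.2))).
  apply: ge_inf; first by exists 0 => _ [y _ <-]; exact: rnorm_ge0.
  by exists I => //=; rewrite addrAC subrr add0r.
rewrite rnormZ ler_wpM2l ?rnorm_ge0 //; apply: le_trans (rnorm_toC _) _.
by rewrite prod_normE le_max lexx orbT.
Qed.

Lemma is_derive_slice (V W : normedModType C) (F : V -> W) (x v : V) (z : C) :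
  differentiable F (x + z *: v) ->
  is_derive z (1 : C) (fun z => F (x + z *: v)) ('d F (x + z *: v) v).
Proof.
move=> dF; apply/is_derive_rnorm => e e0.
have v0 : 0 < rnorm v + 1 by rewrite ltr_wpDl ?rnorm_ge0.
have [|d d0 Hd] := differentiable_rnorm dF (e := e / (rnorm v + 1)).
  by rewrite divr_gt0.
exists (d / (rnorm v + 1)); first by rewrite divr_gt0.
move=> h; rewrite ltr_pdivlMr // => hd.
have hv : rnorm (h *: v) < d.
  by rewrite rnormZ (le_lt_trans _ hd) // ler_wpM2l ?rnorm_ge0 // lerDl.
have := Hd _ hv; rewrite linearZ /= scalerDl addrA => /le_trans; apply.
rewrite rnormZ.
have -> : e / (rnorm v + 1) * (rnorm h * rnorm v) =
    e * rnorm h * (rnorm v / (rnorm v + 1)) by field; rewrite gt_eqF.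
rewrite ler_piMr ?mulr_ge0 ?rnorm_ge0 ?(ltW e0) //.
by rewrite ler_pdivrMr // mul1r lerDl.
Qed.

End Slices.

Section Perturbation.
Variables (R : realType) (n : nat) (B : set 'rV[R]_n) (sigma : R).
Hypothesis sigma0 : 0 < sigma.
Local Notation C := (Cplx R).
Implicit Types (w : 'rV[R]_n * 'rV[R]_n) (f : 'rV[R]_n -> 'rV[R]_n -> R).

Definition cauchy_const : R := 4 / sigma + 1024 / sigma ^+ 2.

(** A field D of linear forms that plays the role of the differential of f, with
    one constant L for its size and for the quadratic Taylor remainder. For a
    perturbation of size eps this holds with L proportional to eps, uniformly in
    the perturbation; nothing else about analyticity is used afterwards. *)
Record quadratic_jet (L : R) f (D : 'rV[R]_n -> 'rV[R]_n -> 'rV[R]_n * 'rV[R]_n -> R)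
    : Prop := QuadraticJet {
  jetD : forall th I w w', D th I (w + w') = D th I w + D th I w' ;
  jetZ : forall th I (k : R) w, D th I (k *: w) = k * D th I w ;
  jet_bound : forall th I w, B I -> `|D th I w| <= L * `|w| ;
  jet_taylor : forall th I w, B I -> B (I + w.2) -> `|w| <= sigma / 4 ->
    `|f (th + w.1) (I + w.2) - f th I - D th I w| <= L * `|w| ^+ 2 }.

(** Restrict the holomorphic extension to the complex line through a real point
    in the direction w: it is holomorphic and bounded by eps on the disc of radius
    sigma / |w|, where the one-variable Cauchy estimates apply. *)
Lemma perturbation_jet (eps : R) f : 0 <= eps -> perturbation B sigma eps f ->
  exists D, quadratic_jet (cauchy_const * eps) f D.
Proof.
move=> eps0 [F [holF perF extF] supF].
have FM z : complex_nbhd B sigma z -> rnorm (F z) <= eps.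
  move=> zB; rewrite -lee_fin; apply: le_trans supF.
  by apply: ereal_sup_ubound; exists z.
pose D th I w := complex.Re ('d F (toC2 (th, I)) (toC2 w)).
have toC2D w w' : toC2 (w + w') = toC2 w + toC2 w'.
  by rewrite /toC2 /toC !map_mxD.
have toC2Z (k : R) w : toC2 (k *: w) = (k%:C%C : C) *: toC2 w.
  by congr (_, _); apply/rowP => i; rewrite !mxE rmorphM.
have DD th I w w' : D th I (w + w') = D th I w + D th I w'.
  by rewrite /D toC2D linearD ReD.
have DZ th I (k : R) w : D th I (k *: w) = k * D th I w.
  by rewrite /D toC2Z linearZ ReM /= mul0r subr0.
have slice th I w : B I -> 0 < `|w| ->
    [/\ forall z : C, rnorm z < sigma / `|w| ->
       derivable (fun z : C => F (toC2 (th, I) + z *: toC2 w)) z (1 : C),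
     forall z : C, rnorm z < sigma / `|w| ->
       rnorm (F (toC2 (th, I) + z *: toC2 w)) <= eps &
     is_derive (0 : C) (1 : C) (fun z : C => F (toC2 (th, I) + z *: toC2 w))
       ('d F (toC2 (th, I)) (toC2 w))].
  move=> BI w0.
  have inB (z : C) : rnorm z < sigma / `|w| -> complex_nbhd B sigma (toC2 (th, I) + z *: toC2 w).
    by rewrite ltr_pdivlMr // => zw; apply: slice_in_nbhd.
  split=> [z /inB zB|z /inB/FM //|].
    by have [] := is_derive_slice (holF _ zB).
  have /holF : complex_nbhd B sigma (toC2 (th, I) + (0 : C) *: toC2 w).
    by apply: inB; rewrite rnorm0 divr_gt0.
  by move=> /is_derive_slice; rewrite scale0r addr0.
have C1 : 4 / sigma <= cauchy_const.
  rewrite /cauchy_const lerDl; apply: divr_ge0; first exact: ler0n.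
  by apply: exprn_ge0; exact: ltW.
have C2 : 1024 / sigma ^+ 2 <= cauchy_const.
  rewrite /cauchy_const lerDr; apply: divr_ge0; first exact: ler0n.
  exact: ltW.
exists D; split; [exact: DD|exact: DZ|..] => th I w BI.
  have [/eqP w0|] := boolP (`|w| == 0).
    move/normr0_eq0 : (w0) => ->; rewrite -[X in D _ _ X](scale0r (0 : 'rV[R]_n * 'rV[R]_n)).
    by rewrite DZ mul0r !normr0 mulr0.
  rewrite -normr_gt0 normr_id => w0; have [dg gM g0] := slice th I w BI w0.
  apply: le_trans (cauchy_estimate_Re _ dg gM g0) _; first by rewrite divr_gt0.
  have -> : 4 * eps / (sigma / `|w|) = 4 / sigma * (eps * `|w|).
    by field; rewrite !gt_eqF.
  by rewrite -[leRHS]mulrA; apply: ler_wpM2r; rewrite // mulr_ge0.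
move=> BIw; have [/eqP w0 _|] := boolP (`|w| == 0).
  move/normr0_eq0 : (w0) => ->; rewrite -[X in D _ _ X](scale0r (0 : 'rV[R]_n * 'rV[R]_n)).
  by rewrite DZ mul0r subr0 /= !addr0 subrr !normr0 expr0n mulr0.
rewrite -normr_gt0 normr_id => w0 ws; have [dg gM g0] := slice th I w BI w0.
move: dg gM g0; set g := (fun z : C => F _) => dg gM g0.
have {}gM (z : C) : rnorm z < sigma / `|w| -> rnorm (g z) <= eps by exact: gM.
have g1E : g (1 : R)%:C%C = real_complex R (f (th + w.1) (I + w.2)).
  rewrite /g [X in _ + X]scale1r -extF //; congr F; rewrite /toC2 /=.
  by congr (_, _); apply/rowP => i; rewrite !mxE rmorphD.
have g0E : g 0 = real_complex R (f th I) by rewrite /g scale0r addr0 extF.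
move: g g1E g0E dg gM g0 => g g1E g0E dg gM g0.
have rho0 : 0 < sigma / `|w| by rewrite divr_gt0.
have rho1 : `|1 : R| <= sigma / `|w| / 4.
  by rewrite normr1 mulrAC ler_pdivlMr // mul1r.
have := cauchy_taylor rho0 dg gM g0 rho1.
rewrite g1E g0E mul1r expr1n mulr1 => /le_trans; apply.
have -> : 1024 * eps / (sigma / `|w|) ^+ 2 = 1024 / sigma ^+ 2 * (eps * `|w| ^+ 2).
  by field; rewrite !gt_eqF.
rewrite -[leRHS]mulrA; apply: ler_wpM2r; last exact: C2.
by rewrite mulr_ge0 // exprn_ge0.
Qed.

Lemma perturbation_periodic (eps : R) f th I (k : 'rV[int]_n) : B I ->
  perturbation B sigma eps f -> f (th + map_mx intr k) I = f th I.
Proof.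
move=> BI [F [holF perF extF] _].
have H : complex_nbhd B sigma (toC2 (th, I)).
  have := @slice_in_nbhd R n B sigma th I 0 0 BI.
  by rewrite scale0r addr0; apply; rewrite rnorm0 mul0r.
have := perF _ k H; rewrite /= !extF //.
have -> : toC th + intC R k = toC (th + map_mx intr k).
  by apply/rowP => i; rewrite !mxE rmorphD /= rmorph_int.
by rewrite extF // => -[].
Qed.

Lemma perturbation_bound (eps : R) f th I : B I ->
  perturbation B sigma eps f -> `|f th I| <= eps.
Proof.
move=> BI [F [holF perF extF] supF].
have H : complex_nbhd B sigma (toC2 (th, I)).
  have := @slice_in_nbhd R n B sigma th I 0 0 BI.
  by rewrite scale0r addr0; apply; rewrite rnorm0 mul0r.
rewrite -lee_fin; apply: le_trans supF.
apply: ereal_sup_ubound; exists (toC2 (th, I)) => //.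
by rewrite extF // rnorm_real.
Qed.

End Perturbation.

(** * Derivatives along a trajectory *)

Section JetCalculus.
Variables (R : realType) (n : nat) (B : set 'rV[R]_n) (sigma L : R).
Variables (f : 'rV[R]_n -> 'rV[R]_n -> R).
Variables (D : 'rV[R]_n -> 'rV[R]_n -> 'rV[R]_n * 'rV[R]_n -> R).
Hypotheses (sigma0 : 0 < sigma) (L0 : 0 <= L) (jet : quadratic_jet B sigma L f D).

(** The translation c is kept apart because the averaged function below
    evaluates f at translates of the current angle. *)
Lemma is_derive_jet (th I : R -> 'rV[R]_n) (t : R) (th' I' c : 'rV[R]_n) :
  is_derive t (1 : R) th th' -> is_derive t (1 : R) I I' ->
  (\forall s \near t, B (I s)) ->
  is_derive t (1 : R) (fun s => f (th s + c) (I s)) (D (th t + c) (I t) (th', I')).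
Proof.
move=> /is_derive_normP dth /is_derive_normP dI /nbhs_ballP[d0 /= d00 IB].
have {}IB s : `|s - t| < d0 -> B (I s).
  by move=> st; apply: IB; rewrite -ball_normE /= distrC.
have BIt : B (I t) by apply: IB; rewrite subrr normr0.
apply/is_derive_normP => e e0.
pose N : R := `|(th', I')| + 1.
have N0 : 0 < N by rewrite ltr_wpDl.
pose e1 := Num.min 1 (e / (2 * (L + 1))).
have L10 : 0 < L + 1 by rewrite ltr_wpDl.
have e10 : 0 < e1 by rewrite lt_min ltr01 divr_gt0 // mulr_gt0.
have e11 : e1 <= 1 by rewrite ge_min lexx.
have e1e : L * e1 <= e / 2.
  have : e1 <= e / (2 * (L + 1)) by rewrite ge_min lexx orbT.
  rewrite ler_pdivlMr ?mulr_gt0 //.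
  have : 0 <= e1 by exact: ltW.
  by move: L0; nra.
have [d1 d10 Hd1] := dth e1 e10; have [d2 d20 Hd2] := dI e1 e10.
pose d3 := sigma / 4 / N; pose d4 := e / (2 * (L + 1) * N ^+ 2).
have d30 : 0 < d3 by rewrite !divr_gt0.
have d40 : 0 < d4 by rewrite divr_gt0 // !mulr_gt0 // exprn_gt0.
exists (Num.min (Num.min d0 d1) (Num.min d2 (Num.min d3 d4))).
  by rewrite !lt_min d00 d10 d20 d30.
move=> h; rewrite !lt_min => /and3P[/andP[h0 h1] h2 /andP[h3 h4]].
pose De := (th (t + h) - th t, I (t + h) - I t).
pose E := De - h *: (th', I').
have EN : `|E| <= e1 * `|h| by apply: prod_norm_le; [exact: Hd1|exact: Hd2].
have DeE : De = h *: (th', I') + E by rewrite /E addrC subrK.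
have DeN : `|De| <= N * `|h|.
  rewrite DeE; apply: le_trans (ler_normD _ _) _; rewrite normrZ /N mulrDl mul1r.
  by rewrite mulrC lerD2l (le_trans EN) // ler_piMl.
have Bh : B (I t + De.2).
  by rewrite /= addrC subrK; apply: IB; rewrite addrAC subrr add0r.
have Des : `|De| <= sigma / 4.
  by apply: le_trans DeN _; rewrite mulrC -ler_pdivlMr // ltW.
have := jet_taylor jet (th t + c) BIt Bh Des.
rewrite /= [I t + _]addrC subrK.
have -> : th t + c + (th (t + h) - th t) = th (t + h) + c.
  by rewrite addrAC addrA [_ + th (t + h)]addrC addrK.
have DD : D (th t + c) (I t) De =
    h *: D (th t + c) (I t) (th', I') + D (th t + c) (I t) E.
  by rewrite DeE (jetD jet) (jetZ jet).
rewrite DD opprD addrA.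
set X := _ - _ - h *: _; set Y := D _ _ E => XY.
have YN : `|Y| <= e / 2 * `|h|.
  apply: le_trans (jet_bound jet _ _ BIt) _.
  apply: (@le_trans _ _ (L * (e1 * `|h|))); first by rewrite ler_wpM2l.
  by rewrite mulrA ler_wpM2r.
have QN : L * `|De| ^+ 2 <= e / 2 * `|h|.
  apply: (@le_trans _ _ (L * (N * `|h|) ^+ 2)).
    by rewrite ler_wpM2l // ler_pXn2r ?nnegrE // mulr_ge0 // ltW.
  have -> : L * (N * `|h|) ^+ 2 = (L * N ^+ 2 * `|h|) * `|h| by ring.
  rewrite ler_wpM2r //.
  apply: (@le_trans _ _ (L * N ^+ 2 * d4)).
    by rewrite ler_wpM2l ?(ltW h4) // mulr_ge0 // exprn_ge0 // ltW.
  have -> : L * N ^+ 2 * d4 = e / 2 * (L / (L + 1)).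
    by rewrite /d4; field; rewrite !gt_eqF.
  by rewrite ler_piMr ?divr_ge0 ?(ltW e0) // ler_pdivrMr // mul1r lerDl.
have -> : X = X - Y + Y by rewrite subrK.
apply: le_trans (ler_normD _ _) _.
have -> : e * `|h| = e / 2 * `|h| + e / 2 * `|h| by field.
by rewrite lerD // (le_trans XY).
Qed.

Lemma is_derive_along_line (g : 'rV[R]_n -> R) (x v : 'rV[R]_n) (a : R) :
  is_derive (0 : R) (1 : R) (fun h => g (x + h *: v)) a -> is_derive x v g a.
Proof.
move=> [dg <-].
have E : (fun h : R => h^-1 *: ((g \o shift x) (h *: v) - g x)) =
    (fun h => h^-1 *: (((fun h => g (x + h *: v)) \o shift 0) (h *: (1 : R)) -
      g (x + (0 : R) *: v))).
  by apply/funext => h /=; rewrite addr0 scale0r addr0 [h *: 1]mulr1 [x + _]addrC.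
by split; rewrite ?/derivable /derive E.
Qed.

Lemma linear_hamiltonianD (w x y : 'rV[R]_n) :
  linear_hamiltonian w (x + y) = linear_hamiltonian w x + linear_hamiltonian w y.
Proof.
by rewrite /linear_hamiltonian -big_split; apply: eq_bigr => i _; rewrite mxE mulrDr.
Qed.

Lemma linear_hamiltonianZ (w x : 'rV[R]_n) (k : R) :
  linear_hamiltonian w (k *: x) = k * linear_hamiltonian w x.
Proof.
by rewrite /linear_hamiltonian mulr_sumr; apply: eq_bigr => i _; rewrite mxE mulrCA.
Qed.

Lemma linear_hamiltonian_e (w : 'rV[R]_n) i : linear_hamiltonian w 'e_i = w 0 i.
Proof.
rewrite /linear_hamiltonian (bigD1 i) //= mxE !eqxx mulr1 big1 ?addr0 // => j ji.
by rewrite mxE eqxx (negPf ji) mulr0.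
Qed.

Lemma is_derive_linear_hamiltonian (w x v : 'rV[R]_n) :
  is_derive (0 : R) (1 : R) (fun h => linear_hamiltonian w (x + h *: v))
    (linear_hamiltonian w v).
Proof.
apply/is_derive_normP => e e0; exists 1 => // h _.
rewrite scale0r addr0 add0r linear_hamiltonianD linear_hamiltonianZ.
rewrite [X in `|X|](_ : _ = 0) ?normr0 ?mulr_ge0 ?(ltW e0) //.
by rewrite /GRing.scale /=; ring.
Qed.

Lemma is_derive_line (x v : 'rV[R]_n) (t : R) :
  is_derive t (1 : R) (fun s => x + s *: v) v.
Proof.
apply/is_derive_normP => e e0; exists 1 => // h _.
rewrite scalerDl addrA [_ + h *: v - _]addrAC subrr add0r subrr normr0.
by rewrite mulr_ge0 // ltW.
Qed.

Lemma near_line (x v : 'rV[R]_n) (V : set 'rV[R]_n) : nbhs x V ->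
  \forall s \near (0 : R), V (x + s *: v).
Proof.
move=> xV; have : {for 0, continuous (fun s : R => x + s *: v)}.
  by have [/derivable1_diffP/differentiable_continuous] := is_derive_line x v 0.
by apply; rewrite scale0r addr0.
Qed.

Lemma gradient_action (w th I : 'rV[R]_n) : open B -> B I ->
  gradient (fun K => linear_hamiltonian w K + f th K) I =
    w + \row_i D th I (0, 'e_i).
Proof.
move=> oB BI; apply/rowP => i; rewrite !mxE.
apply: derive_val; apply: is_derive_along_line; rewrite -linear_hamiltonian_e.
apply: is_deriveD; first exact: is_derive_linear_hamiltonian.
have := @is_derive_jet (cst th) (fun s => I + s *: 'e_i) 0 0 'e_i 0
  (is_derive_cst _ _ _) (is_derive_line _ _ _) (near_line _ (open_nbhs_nbhs (conj oB BI))).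
by rewrite /= scale0r !addr0.
Qed.

Lemma gradient_angle (w th I : 'rV[R]_n) : B I ->
  gradient (fun th => linear_hamiltonian w I + f th I) th =
    \row_i D th I ('e_i, 0).
Proof.
move=> BI; apply/rowP => i; rewrite !mxE.
apply: derive_val; apply: is_derive_along_line; rewrite -[D _ _ _]add0r.
have BI0 : \forall s \near (0 : R), B (cst I s) by near=> s.
have := @is_derive_jet (fun s => th + s *: 'e_i) (cst I) 0 'e_i 0 0
  (is_derive_line _ _ _) (is_derive_cst _ _ _) BI0.
rewrite /= scale0r !addr0 => H.
have H0 := @is_derive_cst R R R (linear_hamiltonian w I) (0 : R) (1 : R).
have := is_deriveD H0 H.
by congr (is_derive _ _ _ _); apply/funext => s; rewrite fctE /= addr0.
Unshelve. all: by end_near. Qed.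

End JetCalculus.

(** * Near-identity change of actions *)

Section NearIdentity.
Variables (R : realType) (n : nat) (B : set 'rV[R]_n) (sigma L : R).
Variables (f : 'rV[R]_n -> 'rV[R]_n -> R).
Variables (D : 'rV[R]_n -> 'rV[R]_n -> 'rV[R]_n * 'rV[R]_n -> R).
Hypotheses (sigma0 : 0 < sigma) (L0 : 0 <= L) (jet : quadratic_jet B sigma L f D).

Lemma jetD0 th I (u v : 'rV[R]_n) : D th I (u + v, 0) = D th I (u, 0) + D th I (v, 0).
Proof. by rewrite -(jetD jet); congr (D _ _ (_, _)); rewrite addr0. Qed.

Lemma jetZ0 th I k (u : 'rV[R]_n) : D th I (k *: u, 0) = k * D th I (u, 0).
Proof. by rewrite -(jetZ jet); congr (D _ _ (_, _)); rewrite scaler0. Qed.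

Lemma prod_norm0r (u : 'rV[R]_n) : `|(u, 0 : 'rV[R]_n)| = `|u|.
Proof. by rewrite prod_normE /= normr0 max_l. Qed.

Lemma jet_taylor0 th I (u : 'rV[R]_n) : B I -> `|u| <= sigma / 4 ->
  `|f (th + u) I - f th I - D th I (u, 0)| <= L * `|u| ^+ 2.
Proof.
move=> BI us; have := jet_taylor jet (w := (u, 0)) th BI.
by rewrite /= prod_norm0r addr0; apply.
Qed.

Lemma jet_bound0 th I (u : 'rV[R]_n) : B I -> `|D th I (u, 0)| <= L * `|u|.
Proof. by move=> BI; rewrite -prod_norm0r; apply: (jet_bound jet). Qed.

(** Along the segment from th to th + (M h) w, the derivatives in the direction
    h w add up to a telescoping sum, hence to an increment of f; by periodicity
    this increment is also the one along a e_j + p, which is a times the j-th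
    angular derivative up to order a^2. The angular derivative that drives I_j is
    thus, to this order, a derivative along the unperturbed flow. *)
Lemma discrete_homological (w p : 'rV[R]_n) (j : 'I_n) (k : 'rV[int]_n)
    (h a : R) (M : nat) (th I : 'rV[R]_n) :
  B I -> (forall x, f (x + map_mx intr k) I = f x I) ->
  (M%:R * h) *: w + map_mx intr k = a *: 'e_j + p -> 0 < a -> a <= 1 ->
  `|p| <= a ^+ 2 -> 2 * a <= sigma / 4 -> `|h| * `|w| <= sigma / 4 ->
  `|\sum_(m < M) D (th + (m%:R * h) *: w) I (h *: w, 0) - a * D th I ('e_j, 0)|
    <= L * (5 * a ^+ 2 + M%:R * (`|h| * `|w|) ^+ 2).
Proof.
move=> BI per cl a0 a1 pa a2 hw.
pose g m := f (th + (m%:R * h) *: w) I.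
have stp m : `|g m.+1 - g m - D (th + (m%:R * h) *: w) I (h *: w, 0)|
    <= L * (`|h| * `|w|) ^+ 2.
  have := @jet_taylor0 (th + (m%:R * h) *: w) I (h *: w) BI; rewrite /g.
  have -> : m.+1%:R * h = m%:R * h + h by rewrite -addn1 natrD mulrDl mul1r.
  by rewrite scalerDl addrA -normrZ; apply; rewrite normrZ.
have tele : \sum_(m < M) (g m.+1 - g m) = g M - g 0%N.
  by rewrite -(big_mkord xpredT (fun m => g m.+1 - g m)) telescope_sumr.
pose S := \sum_(m < M) (g m.+1 - g m - D (th + (m%:R * h) *: w) I (h *: w, 0)).
have SE : \sum_(m < M) D (th + (m%:R * h) *: w) I (h *: w, 0) = g M - g 0%N - S.
  by rewrite /S sumrB tele opprB addrC subrK.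
have SN : `|S| <= M%:R * (L * (`|h| * `|w|) ^+ 2).
  apply: le_trans (ler_norm_sum _ _ _) _.
  apply: (@le_trans _ _ (\sum_(m < M) L * (`|h| * `|w|) ^+ 2)).
    by apply: ler_sum => m _; apply: stp.
  by rewrite sumr_const card_ord mulr_natl.
have gM : g M = f (th + (a *: 'e_j + p)) I.
  by rewrite /g -per -[th + _ + _]addrA cl.
have g0 : g 0%N = f th I by rewrite /g mul0r scale0r addr0.
have eN : `|'e_j : 'rV[R]_n| <= 1.
  by apply: row_norm_le => // i; rewrite mxE; case: (_ && _); rewrite ?normr1 ?normr0.
have a21 : a ^+ 2 <= a by rewrite expr2 ler_piMl // ltW.
have uN : `|a *: 'e_j + p| <= 2 * a.
  apply: le_trans (ler_normD _ _) _; rewrite normrZ (ger0_norm (ltW a0)).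
  have : a * `|'e_j : 'rV[R]_n| <= a by rewrite ler_piMr // ltW.
  by move: pa a21; lra.
have T := @jet_taylor0 th I _ BI (le_trans uN a2).
have {}T : `|g M - g 0%N - D th I (a *: 'e_j + p, 0)| <= L * (4 * a ^+ 2).
  rewrite gM g0; apply: le_trans T _; rewrite ler_wpM2l //.
  have -> : 4 * a ^+ 2 = (2 * a) ^+ 2 by ring.
  by rewrite ler_pXn2r ?nnegrE // mulr_ge0 // ltW.
have pN : `|D th I (p, 0)| <= L * a ^+ 2.
  by apply: le_trans (jet_bound0 _ _ BI) _; rewrite ler_wpM2l.
move: T; rewrite jetD0 jetZ0 SE.
set X := g M - g 0%N; set Y := a * D _ _ _; set Z := D _ _ _ in pN * => T.
have -> : X - S - Y = (X - (Y + Z)) + (Z - S) by ring.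
apply: le_trans (ler_normD _ _) _; have := ler_normB Z S.
have -> : L * (5 * a ^+ 2 + M%:R * (`|h| * `|w|) ^+ 2) =
  L * (4 * a ^+ 2) + (L * a ^+ 2 + M%:R * (L * (`|h| * `|w|) ^+ 2)) by ring.
by move: T pN SN; lra.
Qed.

(** The corrected action K = I_j + (h / a) sum_m f (th + m h w, I) has a small
    derivative: by discrete_homological the derivative of the sum along the
    unperturbed flow cancels that of I_j, up to terms
    that are small with a or with the step h, and what remains is quadratic in f.
    The correction itself is of the size of f, so K and I_j stay close. *)
Lemma near_identity_drift (w p : 'rV[R]_n) (j : 'I_n) (k : 'rV[int]_n)
    (h a eps : R) (M : nat) (J : set R) (th I : R -> 'rV[R]_n) (t : R) :
  open B -> (forall x K, B K -> `|f x K| <= eps) ->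
  (forall x K, B K -> f (x + map_mx intr k) K = f x K) ->
  hamiltonian_solution B (fun x K => linear_hamiltonian w K + f x K) J th I ->
  J t ->
  (M%:R * h) *: w + map_mx intr k = a *: 'e_j + p -> 0 < a -> a <= 1 ->
  `|p| <= a ^+ 2 -> 2 * a <= sigma / 4 -> `|h| * `|w| <= sigma / 4 ->
  `|I t 0 j - I 0 0 j| <=
    `|t| * (L * (5 * a + M%:R * (`|h| * `|w|) ^+ 2 / a) + `|h| / a * M%:R * L ^+ 2)
    + 2 * (`|h| / a * M%:R * eps).
Proof.
move=> oB fe per [oJ itvJ J0 sol] Jt cl a0 a1 pa a2 hw.
pose A s := \row_i D (th s) (I s) (0, 'e_i).
pose G s := \row_i D (th s) (I s) ('e_i, 0).
have dth s : J s -> is_derive s (1 : R) th (w + A s).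
  by move=> /sol[BI + _]; rewrite (gradient_action sigma0 L0 jet).
have dI s : J s -> is_derive s (1 : R) I (- G s).
  by move=> /sol[BI _]; rewrite (gradient_angle sigma0 L0 jet).
have BJ s : J s -> B (I s) by case/sol.
have eN i : `|'e_i : 'rV[R]_n| <= 1.
  by apply: row_norm_le => // i'; rewrite mxE; case: (_ && _); rewrite ?normr1 ?normr0.
have AN s : J s -> `|A s| <= L.
  move=> /BJ BI; apply: row_norm_le => // i; rewrite mxE.
  apply: le_trans (jet_bound jet _ _ BI) _.
  by rewrite ler_piMr // prod_norm_le /= ?normr0.
have GN s : J s -> `|G s| <= L.
  move=> /BJ BI; apply: row_norm_le => // i; rewrite mxE.
  apply: le_trans (jet_bound jet _ _ BI) _.
  by rewrite ler_piMr // prod_norm_le /= ?normr0.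
pose K s := I s 0 j + h / a * \sum_(m < M) f (th s + (m%:R * h) *: w) (I s).
pose dK s := - G s 0 j +
  h / a * \sum_(m < M) D (th s + (m%:R * h) *: w) (I s) (w + A s, - G s).
have Kder s : J s -> is_derive s (1 : R) K (dK s).
  move=> Js; have dIs := dI s Js; have dths := dth s Js.
  have dIj : is_derive s (1 : R) (fun s => I s 0 j) (- G s 0 j).
    have /is_derive_normP H := dIs; apply/is_derive_normP => e e0.
    have [d d0 Hd] := H e e0; exists d => // x /Hd; apply: le_trans.
    by apply: le_trans (row_norm_ge _ j); rewrite !mxE.
  have nB : \forall s' \near s, B (I s').
    by apply: filterS (open_nbhs_nbhs (conj oJ Js)) => s' /BJ.
  have dS := is_derive_sum (fun m : 'I_M =>
    is_derive_jet sigma0 L0 jet ((m%:R * h) *: w) dths dIs nB).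
  have := is_deriveD dIj (is_deriveZ (h / a) dS).
  by congr (is_derive _ _ _ _); apply/funext => s'; rewrite /K fctE /= fct_sumE.
have dKN s : J s -> `|dK s| <=
    L * (5 * a + M%:R * (`|h| * `|w|) ^+ 2 / a) + `|h| / a * M%:R * L ^+ 2.
  move=> Js; have BI := BJ s Js.
  pose S1 := \sum_(m < M) D (th s + (m%:R * h) *: w) (I s) (h *: w, 0).
  pose S2 := \sum_(m < M) D (th s + (m%:R * h) *: w) (I s) (A s, - G s).
  have -> : dK s = a^-1 * (S1 - a * D (th s) (I s) ('e_j, 0)) + h / a * S2.
    have -> : S1 = h * \sum_(m < M) D (th s + (m%:R * h) *: w) (I s) (w, 0).
      by rewrite mulr_sumr; apply: eq_bigr => m _; rewrite jetZ0.
    rewrite /dK; set S3 := \sum_(m < M) D _ _ (w, 0).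
    have -> : \sum_(m < M) D (th s + (m%:R * h) *: w) (I s) (w + A s, - G s) = S3 + S2.
      rewrite -big_split /=; apply: eq_bigr => m _; rewrite -(jetD jet).
      by congr (D _ _ (_, _)); rewrite add0r.
    by rewrite mxE; field; rewrite gt_eqF.
  have S1N := discrete_homological (th s) BI (fun x => per x _ BI) cl a0 a1 pa a2 hw.
  have S2N : `|S2| <= M%:R * L ^+ 2.
    apply: le_trans (ler_norm_sum _ _ _) _.
    apply: (@le_trans _ _ (\sum_(m < M) L ^+ 2)); last first.
      by rewrite sumr_const card_ord mulr_natl.
    apply: ler_sum => m _; apply: le_trans (jet_bound jet _ _ BI) _.
    by rewrite expr2 ler_wpM2l // prod_norm_le /= ?normrN ?AN ?GN.
  apply: le_trans (ler_normD _ _) _; apply: lerD.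
    have -> : L * (5 * a + M%:R * (`|h| * `|w|) ^+ 2 / a) =
        a^-1 * (L * (5 * a ^+ 2 + M%:R * (`|h| * `|w|) ^+ 2)).
      by field; rewrite gt_eqF.
    have ai0 : 0 <= a^-1 by rewrite invr_ge0 ltW.
    by rewrite normrM ger0_norm // ler_wpM2l.
  rewrite normrM normrM normfV (ger0_norm (ltW a0)) -[leRHS]mulrA ler_wpM2l //.
  by rewrite divr_ge0 // ltW.
have Jseg s : Num.min 0 t <= s <= Num.max 0 t -> J s.
  move=> st; case: (lerP 0 t) st => t0 st.
    exact: (itvJ 0 t J0 Jt).
  exact: (itvJ t 0 Jt J0).
have KN : `|K t - K 0| <=
    (L * (5 * a + M%:R * (`|h| * `|w|) ^+ 2 / a) + `|h| / a * M%:R * L ^+ 2)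
    * `|t - 0|.
  apply: (@derive_bound R K dK) => s /Jseg Js; first exact: Kder.
  exact: dKN.
have PN s : J s -> `|h / a * \sum_(m < M) f (th s + (m%:R * h) *: w) (I s)| <=
    `|h| / a * M%:R * eps.
  move=> Js; rewrite normrM normrM normfV (ger0_norm (ltW a0)) -[leRHS]mulrA.
  rewrite ler_wpM2l ?divr_ge0 ?(ltW a0) //.
  apply: le_trans (ler_norm_sum _ _ _) _.
  apply: (@le_trans _ _ (\sum_(m < M) eps)); last first.
    by rewrite sumr_const card_ord mulr_natl.
  by apply: ler_sum => m _; apply/fe/BJ.
have P0 := PN 0 J0; have Pt := PN t Jt.
move: KN; rewrite subr0 [_ * `|t|]mulrC /K.
move: P0 Pt; set x0 := _ * \sum_(m < M) _; set xt := _ * \sum_(m < M) _.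
move=> P0 Pt KN.
have -> : I t 0 j - I 0 0 j = (I t 0 j + xt - (I 0 0 j + x0)) + (x0 - xt) by ring.
apply: le_trans (ler_normD _ _) _; have := ler_normB x0 xt.
by move: KN P0 Pt; lra.
Qed.

End NearIdentity.

(** * Time means of trigonometric sums *)

Section TrigMean.
Variable R : realType.

(** The sum has an explicit primitive, namely c k0 * s plus a bounded function;
    if the sum is bounded by b, the growth rate c k0 cannot exceed b. *)
Lemma trig_mean_le (I : finType) (k0 : I) (c la ph : I -> R) (b : R) :
  la k0 = 0 -> ph k0 = 0 -> (forall k, k != k0 -> la k != 0) ->
  (forall s, `|\sum_k c k * cos (la k * s + ph k)| <= b) -> c k0 <= b.
Proof.
move=> la0 ph0 laN Pb.
pose q k s := if k == k0 then c k0 * s else c k / la k * sin (la k * s + ph k).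
pose Q s := \sum_k q k s.
have dq k s : is_derive s (1 : R) (q k) (c k * cos (la k * s + ph k)).
  have dlin (u v : R) : is_derive s (1 : R) (fun s => u * s + v) u.
    apply/is_derive_normP => e e0; exists 1 => // h _.
    rewrite [X in `|X|](_ : _ = 0) ?normr0 ?mulr_ge0 ?(ltW e0) //.
    by rewrite /GRing.scale /=; ring.
  have [->|kk0] := eqVneq k k0.
    have -> : q k0 = (fun s => c k0 * s + 0).
      by apply/funext => x; rewrite /q eqxx addr0.
    by rewrite la0 ph0 mul0r addr0 cos0 mulr1.
  have -> : q k = (c k / la k) \*: (sin \o (fun s => la k * s + ph k)).
    by apply/funext => x; rewrite /q (negPf kk0).
  have dsin := @is_derive1_comp R sin _ _ _ _ (is_derive_sin _) (dlin (la k) (ph k)).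
  apply: is_derive_eq (is_deriveZ (c k / la k) dsin) _.
  by rewrite /GRing.scale /=; field; exact: laN.
have dQ s : is_derive s (1 : R) Q (\sum_k c k * cos (la k * s + ph k)).
  have -> : Q = \sum_k q k by apply/funext => x; rewrite /Q fct_sumE.
  by elim/big_ind2 : _ => // [|] *; [exact: is_derive_cst|exact: is_deriveD].
pose K := \sum_(k | k != k0) `|c k / la k| * 2.
have K0 : 0 <= K by apply: sumr_ge0 => k _; rewrite mulr_ge0.
have lin s : 0 <= s -> c k0 * s <= b * s + K.
  move=> s0.
  have := @derive_bound R Q _ 0 s b (fun x _ => dQ x) (fun x _ => Pb x).
  rewrite subr0 (ger0_norm s0).
  have -> : Q s - Q 0 = c k0 * s +
      \sum_(k | k != k0) c k / la k * (sin (la k * s + ph k) - sin (ph k)).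
    rewrite /Q [X in X - _](bigD1 k0) //= [X in _ - X](bigD1 k0) //= /q eqxx.
    rewrite mulr0 add0r -addrA; congr (_ + _).
    rewrite -sumrB; apply: eq_bigr => k /negPf ->.
    by rewrite mulr0 add0r mulrBr.
  set S := \sum_(k | _) _ => H.
  have SK : `|S| <= K.
    apply: le_trans (ler_norm_sum _ _ _) _; apply: ler_sum => k _.
    rewrite normrM ler_wpM2l //; apply: le_trans (ler_normB _ _) _.
    by rewrite (_ : 2 = 1 + 1) ?lerD ?sin_max.
  by move: H SK; rewrite !ler_norml => /andP[_ H] /andP[H' _]; lra.
rewrite leNgt; apply/negP => bc.
have d0 : 0 < c k0 - b by rewrite subr_gt0.
have := lin ((K + 1) / (c k0 - b)).
have -> : c k0 * ((K + 1) / (c k0 - b)) = b * ((K + 1) / (c k0 - b)) + (K + 1).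
  by field; rewrite gt_eqF.
rewrite divr_ge0 ?(ltW d0) ?addr_ge0 // => /(_ isT); lra.
Qed.

Definition cis (t : R) : Cplx R := Complex (cos t) (sin t).

Lemma cisD s t : cis (s + t) = cis s * cis t.
Proof. by apply: ReIm_eq; rewrite ?ReM ?ImM /= ?cosD ?sinD; ring. Qed.

Lemma cis0 : cis 0 = 1.
Proof. by apply: ReIm_eq; rewrite /= ?cos0 ?sin0. Qed.

Lemma cisX t k : cis t ^+ k = cis (k%:R * t).
Proof.
elim: k => [|k IH]; first by rewrite expr0 mul0r cis0.
by rewrite exprS IH -cisD -[k.+1]add1n natrD mulrDl mul1r.
Qed.

Lemma cos_pow_expansion N t : ((cos t ^+ N)%:C%C : Cplx R) =
  \sum_(k < N.+1) (('C(N, k))%:R / 2 ^+ N)%:C%C * cis ((N%:R - 2 * k%:R) * t).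
Proof.
have -> : cos t ^+ N = 2 ^- N * (cos t + cos t) ^+ N.
  by rewrite -exprVn -exprMn; congr (_ ^+ _); field.
have E : ((cos t + cos t)%:C%C : Cplx R) = cis t + cis (- t).
  by apply: ReIm_eq; rewrite ?ReD ?ImD /= ?cosN ?sinN ?subrr.
rewrite rmorphM rmorphXn /= E (exprDn (cis t)) mulr_sumr; apply: eq_bigr => k _.
have kN : (k <= N)%N by rewrite -ltnS.
rewrite !cisX -cisD.
have -> : (N - k)%:R * t + k%:R * - t = (N%:R - 2 * k%:R) * t.
  by rewrite natrB //; ring.
by rewrite rmorphM /= rmorph_nat mulrC -mulrA -mulr_natl mulrA mulrAC.
Qed.

(** Write cos as the half-sum of two opposite exponentials, expand by the
    binomial formula, and multiply out; the frequencies that appear are integral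
    combinations of the arguments. *)
Lemma prod_cos_expansion n N (x : 'I_n -> R) :
  \prod_i cos (x i) ^+ N =
  \sum_(k : {ffun 'I_n -> 'I_N.+1}) (\prod_i (('C(N, k i))%:R / 2 ^+ N)) *
    cos (\sum_i (N%:R - 2 * (k i)%:R) * x i).
Proof.
have E : ((\prod_i cos (x i) ^+ N)%:C%C : Cplx R) =
    \sum_(k : {ffun 'I_n -> 'I_N.+1}) (\prod_i (('C(N, k i))%:R / 2 ^+ N))%:C%C *
    cis (\sum_i (N%:R - 2 * (k i)%:R) * x i).
  rewrite rmorph_prod /=.
  under eq_bigr => i _ do rewrite cos_pow_expansion.
  rewrite bigA_distr_bigA /=; apply: eq_bigr => k _.
  by rewrite big_split /= -rmorph_prod (big_morph _ cisD cis0).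
have -> : \prod_i cos (x i) ^+ N = complex.Re ((\prod_i cos (x i) ^+ N)%:C%C : Cplx R).
  by [].
rewrite E (big_morph _ (@ReD R) (erefl : complex.Re (0 : Cplx R) = 0)).
by apply: eq_bigr => k _; rewrite ReM /= mul0r subr0.
Qed.

End TrigMean.

(** * Kronecker theorem *)

Lemma central_binomial m : (4 ^ m <= (2 * m).+1 * 'C(2 * m, m))%N.
Proof.
elim: m => [//|m IH].
have d1 := mul_bin_diag (2 * m.+1) m.
have d2 := mul_bin_diag (2 * m).+1 m.
have sym : 'C((2 * m).+1, m.+1) = 'C((2 * m).+1, m).
  rewrite -(bin_sub (m := m.+1)); last by rewrite ltnS leq_pmull.
  by congr 'C(_, _); rewrite mul2n -addnn subSS addnK.
rewrite sym /= in d2.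
have e1 : (2 * m.+1 = (2 * m).+2)%N by rewrite mulnS.
rewrite e1 /= in d1 *.
rewrite expnS.
have : (m.+1 * 'C((2 * m).+2, m.+1) = 2 * ((2 * m).+1 * 'C(2 * m, m)))%N.
  by rewrite -d1 d2 -e1 mulnA.
set X := 'C(_, _); set Y := 'C(_, _) in IH * => XY.
have : (m.+1 * (4 * 4 ^ m) <= m.+1 * ((2 * m).+3 * X))%N; last by rewrite leq_pmul2l.
rewrite [X in (_ <= X)%N]mulnCA XY.
apply: (@leq_trans (m.+1 * (4 * ((2 * m).+1 * Y)))); first by rewrite !leq_mul2l IH !orbT.
rewrite !mulnA leq_mul2r; apply/orP; right; rewrite leq_mul2r; apply/orP; right.
by rewrite mulnC; lia.
Qed.

Section Kronecker.
Variable R : realType.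

Lemma exp_beats_poly (q : R) n : 0 < q -> q < 1 ->
  exists m : nat, q ^+ m * (2 * m).+1%:R ^+ n < 1.
Proof.
move=> q0 q1; pose p := q^-1 - 1.
have p0 : 0 < p by rewrite subr_gt0 invf_gt1.
have bern M : M%:R * p <= q ^- M.
  have -> : q ^- M = (1 + p) ^+ M by rewrite -exprVn /p addrC subrK.
  elim: M => [|M IH]; first by rewrite mul0r expr0.
  rewrite exprS mulrDl mul1r -natr1 mulrDl mul1r lerD // ler_peMr ?(ltW p0) //.
  by rewrite exprn_ege1 // lerDl ltW.
(* With the exponent M (n + 1), Bernoulli gives q ^ (M (n + 1)) <=
   (M p) ^ - (n + 1), which beats (M (2 n + 3)) ^ n as soon as M > T. *)
pose T := (2 * n + 3)%:R ^+ n / p ^+ n.+1 : R.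
pose M := (Num.truncn T).+1.
have TM : T < M%:R by rewrite truncnS_gt.
have M0 : (0 : R) < M%:R by rewrite ltr0n.
exists (M * n.+1)%N.
have qM : q ^+ M <= (M%:R * p)^-1.
  by rewrite -[q ^+ M]invrK lef_pV2 ?posrE ?mulr_gt0 ?invr_gt0 ?exprn_gt0.
have s1 : q ^+ (M * n.+1) <= (M%:R * p)^-1 ^+ n.+1.
  by rewrite exprM lerXn2r ?nnegrE ?invr_ge0 ?mulr_ge0 ?exprn_ge0
    ?(ltW q0) ?(ltW p0) ?(ltW M0).
have s2 : (2 * (M * n.+1)).+1%:R ^+ n <= (M%:R * (2 * n + 3)%:R) ^+ n :> R.
  by rewrite lerXn2r ?nnegrE // -natrM ler_nat; lia.
apply: le_lt_trans (ler_pM _ _ s1 s2) _; rewrite ?exprn_ge0 ?(ltW q0) //.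
have -> : (M%:R * p)^-1 ^+ n.+1 * (M%:R * (2 * n + 3)%:R) ^+ n = T / M%:R.
  rewrite /T exprVn exprS [p ^+ n.+1]exprS !exprMn.
  have Mn0 : (M%:R : R) ^+ n != 0 by rewrite expf_neq0 // gt_eqF.
  have pn0 : p ^+ n != 0 by rewrite expf_neq0 // gt_eqF.
  by field; rewrite Mn0 pn0 !gt_eqF.
by rewrite ltr_pdivrMr // mul1r.
Qed.

Lemma cos_sq_shift (x : R) (k : int) : cos (x + k%:~R * pi) ^+ 2 = cos x ^+ 2.
Proof.
have nat_shift (y : R) (j : nat) : cos (y + j%:R * pi) ^+ 2 = cos y ^+ 2.
  elim: j => [|j IH]; first by rewrite mul0r addr0.
  by rewrite -natr1 mulrDl mul1r addrA cosDpi sqrrN IH.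
case: k => j; first exact: nat_shift.
rewrite NegzE mulrNz mulNr -[in RHS](subrK (j.+1%:R * pi) x); exact/esym/nat_shift.
Qed.

(** The left-hand side depends only on the distance from y to the nearest
    integer, and decreases as this distance grows to 1/2. *)
Lemma cos_sq_far (eta y : R) : 0 < eta -> eta < 1 / 2 ->
  (forall k : int, eta < `|y - k%:~R|) -> cos (pi * y) ^+ 2 <= cos (pi * eta) ^+ 2.
Proof.
move=> e0 e1 far.
pose k := Num.floor y; pose r := y - k%:~R.
have /andP[k0 k1] := floor_itv y.
have r0 : 0 <= r by rewrite subr_ge0.
have {}k1 : r < 1 by move: k1; rewrite rmorphD /= -/k /r; lra.
have er : eta < r by have := far k; rewrite -/r ger0_norm.
have er1 : eta < 1 - r.
  have := far (k + 1); rewrite rmorphD /= opprD addrA -/r ler0_norm ?opprB //.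
  by rewrite subr_le0 ltW.
have -> : pi * y = pi * r + k%:~R * pi by rewrite /r; ring.
rewrite cos_sq_shift.
have pi0 : (0 : R) < pi := pi_gt0 R.
have lecos (a b : R) : 0 <= a -> a <= b -> b <= pi -> cos b <= cos a.
  move=> a0 ab bpi; rewrite leNgt ltr_cos -?leNgt // in_itv /=.
    by rewrite (le_trans a0 ab) bpi.
  by rewrite a0 (le_trans ab bpi).
have pe : pi * eta <= pi * r by rewrite ler_pM2l // ltW.
have pr : pi * eta <= pi - pi * r by rewrite -{2}[pi]mulr1 -mulrBr ler_pM2l // ltW.
have pe0 : 0 <= pi * eta by rewrite mulr_ge0 // ltW.
have pr0 : 0 <= pi * r by rewrite mulr_ge0 // ltW.
have c1 : cos (pi * r) <= cos (pi * eta) by apply: lecos => //; lra.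
have c2 : - cos (pi * eta) <= cos (pi * r).
  have -> : - cos (pi * eta) = cos (- (pi * eta) + pi) by rewrite cosDpi cosN.
  by apply: lecos => //; lra.
have c0 : `|cos (pi * r)| <= cos (pi * eta) by rewrite ler_norml c1 c2.
rewrite -[leLHS]real_normK ?num_real // ler_pXn2r ?nnegrE //.
exact: le_trans (normr_ge0 _) c0.
Qed.

(** If the line s w stayed at distance more than eta from x modulo the integers,
    then the product of the cos (pi (s w_i - x_i)) ^+ (2 m) would be at most q ^ m
    for all s, with q < 1. But nonresonance makes its time mean the constant
    Fourier coefficient, which is the n-th power of binomial (2 m, m) / 4 ^ m and
    so at least (2 m + 1) ^ (- n): impossible for large m. *)
Lemma kronecker n (w x : 'rV[R]_n) (eta : R) : 0 < eta ->
  (forall k : 'rV[int]_n, k != 0 -> \sum_i (k 0 i)%:~R * w 0 i != 0) ->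
  exists (s : R) (k : 'rV[int]_n), `|s *: w + map_mx intr k - x| <= eta.
Proof.
move=> eta0 nonres.
wlog eta12 : eta eta0 / eta < 1 / 2.
  move=> H; have [||s [k sk]] := H (Num.min eta (1 / 4)).
  - by rewrite lt_min eta0 /=; lra.
  - by rewrite gt_min; apply/orP; right; lra.
  - by exists s, k; apply: le_trans sk _; rewrite ge_min lexx.
apply: contrapT => Hno.
have far s : exists i, forall k : int, eta < `|s * w 0 i - x 0 i - k%:~R|.
  apply: contrapT => Hs; apply: Hno.
  have near i : exists k : int, `|s * w 0 i - x 0 i - k%:~R| <= eta.
    apply: contrapT => Hi; apply: Hs; exists i => k; rewrite ltNge; apply/negP => Hk.
    by apply: Hi; exists k.
  pose K i := projT1 (cid (near i)).
  exists s, (\row_i (- K i)); apply: row_norm_le => [|i]; first exact: ltW.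
  rewrite !mxE rmorphN /= addrAC; exact: (projT2 (cid (near i))).
pose q := cos (pi * eta) ^+ 2.
have pi0 : (0 : R) < pi := pi_gt0 R.
have ce : 0 < cos (pi * eta) < 1.
  apply/andP; split.
    apply: cos_gt0_pihalf; have : 0 < pi * eta by rewrite mulr_gt0.
    have : pi * eta < pi / 2 by rewrite ltr_pM2l //; move: eta12; lra.
    by move=> *; apply/andP; split; lra.
  rewrite -[ltRHS]cos0 ltr_cos ?mulr_gt0 // in_itv /= ?lexx ?(ltW pi0) //.
  by rewrite mulr_ge0 ?(ltW pi0) ?(ltW eta0) //= ler_piMr ?(ltW pi0) //; lra.
have q01 : 0 < q < 1.
  by case/andP: ce => ce0 ce1; rewrite exprn_gt0 // exprn_ilt1 // ltW.
have [m qm] : exists m : nat, q ^+ m * (2 * m).+1%:R ^+ n < 1.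
  by case/andP: q01 => *; apply: exp_beats_poly.
pose N := (2 * m)%N.
have mN : (m < N.+1)%N by rewrite ltnS leq_pmull.
pose k0 : {ffun 'I_n -> 'I_N.+1} := [ffun => Ordinal mN].
pose la (k : {ffun 'I_n -> 'I_N.+1}) := \sum_i (N%:R - 2 * (k i)%:R) * (pi * w 0 i).
pose ph (k : {ffun 'I_n -> 'I_N.+1}) := - \sum_i (N%:R - 2 * (k i)%:R) * (pi * x 0 i).
pose c (k : {ffun 'I_n -> 'I_N.+1}) : R := \prod_i (('C(N, k i))%:R / 2 ^+ N).
have zero0 i : N%:R - 2 * (k0 i)%:R = 0 :> R by rewrite ffunE /= natrM subrr.
have la0 : la k0 = 0 by rewrite /la big1 // => i _; rewrite zero0 mul0r.
have ph0 : ph k0 = 0 by rewrite /ph big1 ?oppr0 // => i _; rewrite zero0 mul0r.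
have laN k : k != k0 -> la k != 0.
  move=> kk0; pose kz : 'rV[int]_n := \row_i (m%:Z - (k i)%:Z).
  have -> : la k = 2 * pi * \sum_i (kz 0 i)%:~R * w 0 i.
    rewrite mulr_sumr; apply: eq_bigr => i _.
    by rewrite mxE rmorphB /= -!pmulrn natrM; ring.
  rewrite mulf_neq0 //; first by rewrite mulf_neq0 // gt_eqF.
  apply: nonres; apply: contraNneq kk0 => /rowP kz0; apply/eqP/ffunP => i.
  apply/val_inj; rewrite ffunE /=; have := kz0 i; rewrite !mxE => /eqP.
  by rewrite subr_eq0 => /eqP[].
have Pq s : `|\sum_k c k * cos (la k * s + ph k)| <= q ^+ m.
  have -> : \sum_k c k * cos (la k * s + ph k) =
      \prod_i cos (pi * (s * w 0 i - x 0 i)) ^+ N.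
    rewrite prod_cos_expansion; apply: eq_bigr => k _; congr (_ * cos _).
    rewrite /la /ph mulr_suml -sumrB; apply: eq_bigr => i _; ring.
  have [i Hi] := far s.
  rewrite (bigD1 i) //= normrM.
  have pow y : `|cos y ^+ N| = (cos y ^+ 2) ^+ m :> R.
    by rewrite /N exprM ger0_norm // exprn_ge0 // sqr_ge0.
  have cle : `|cos (pi * (s * w 0 i - x 0 i)) ^+ N| <= q ^+ m.
    rewrite pow lerXn2r ?nnegrE ?sqr_ge0 //; exact: cos_sq_far.
  rewrite -[leRHS]mulr1; apply: ler_pM => //.
  rewrite normr_prod; apply: prodr_ile1 => j; rewrite normr_ge0 normrX /=.
  by rewrite exprn_ile1 // cos_max.
have := trig_mean_le la0 ph0 laN Pq.
have -> : c k0 = ('C(N, m)%:R / 2 ^+ N) ^+ n.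
  rewrite /c (eq_bigr (fun=> 'C(N, m)%:R / 2 ^+ N)); last by move=> i _; rewrite ffunE.
  by rewrite prodr_const card_ord.
apply/negP; rewrite -ltNge.
have b0 : (0 : R) < N.+1%:R by rewrite ltr0n.
have cb : (N.+1%:R)^-1 <= 'C(N, m)%:R / 2 ^+ N :> R.
  rewrite ler_pdivlMr ?exprn_gt0 // ler_pdivrMl // -natrM -natrX ler_nat.
  by rewrite /N expnM central_binomial.
apply: (@lt_le_trans _ _ ((N.+1%:R)^-1 ^+ n)).
  by rewrite exprVn -[ltRHS]mul1r ltr_pdivlMr // exprn_gt0.
by rewrite lerXn2r ?nnegrE ?invr_ge0 // divr_ge0 // exprn_ge0.
Qed.

End Kronecker.

(** * Stability of nonresonant linear Hamiltonians *)

Section Stability.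
Variables (R : realType) (n : nat).
Implicit Types (w c : 'rV[R]_n).

(** If w is orthogonal to a nonzero integer vector k, then the Hamiltonian is
    constant on the lines directed by k: all points of c + R k in the ball are
    critical, and c is not isolated among them. *)
Lemma rationally_steep_nonresonant w c (r : R) : 0 < r ->
  rationally_steep (ball c r) (linear_hamiltonian w) ->
  forall k : 'rV[int]_n, k != 0 -> \sum_i (k 0 i)%:~R * w 0 i != 0.
Proof.
move=> r0 steep k k0; apply/eqP => res.
pose kR : 'rV[R]_n := map_mx intr k.
have kR0 : kR != 0.
  apply: contraNneq k0 => /rowP kz; apply/eqP/rowP => i.
  by have := kz i; rewrite !mxE => /eqP; rewrite intr_eq0 => /eqP.
pose L := <<[:: kR]>>%VS.
have LP v : v \in L -> exists a, v = a *: kR.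
  by rewrite /L span_seq1 => /vlineP.
have cB : ball c r c by exact: ballxx.
have ratL : rational_subspace L by exists [:: k].
have crit x : ball c r x -> x - c \in L ->
    restriction_critical_points (ball c r) (linear_hamiltonian w) c L x.
  move=> xB xL; split=> // v /LP[a ->]; apply: is_derive_along_line.
  have := is_derive_linear_hamiltonian w x (a *: kR).
  rewrite linear_hamiltonianZ [X in a * X](_ : _ = 0) ?mulr0 // -res.
  by apply: eq_bigr => i _; rewrite mxE mulrC.
have [|_ [V cV VC]] := steep c L cB ratL c; first by apply: crit; rewrite ?subrr ?mem0v.
have nV : \forall s \near (0 : R), V (c + s *: kR) by exact: near_line.
have nB : \forall s \near (0 : R), ball c r (c + s *: kR).
  by apply: near_line; exact: nbhsx_ballx.
have /nbhs_ballP[d /= d0 Hd] : nbhs (0 : R)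
    (fun s => V (c + s *: kR) /\ ball c r (c + s *: kR)).
  by apply: filterI.
have [Vs Bs] : V (c + (d / 2) *: kR) /\ ball c r (c + (d / 2) *: kR).
  apply: Hd; rewrite -ball_normE /= sub0r normrN ger0_norm ?divr_ge0 ?(ltW d0) //.
  by rewrite ltr_pdivrMr //; lra.
have : [set c] (c + (d / 2) *: kR).
  rewrite -VC; split=> //; apply: crit => //.
  by rewrite addrAC subrr add0r /L span_seq1; apply/vlineP; exists (d / 2).
move=> /= /eqP; rewrite -subr_eq0 addrAC subrr add0r scaler_eq0 (negPf kR0) orbF.
by rewrite gt_eqF // divr_gt0.
Qed.

(** The constants are chosen in the order a, s, M, eps: first a makes the error
    of order a small, then Kronecker's theorem gives the time s at which s w
    returns close to a e_j, then the number M of sampling points makes the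
    discretisation error small, and the terms left carry a factor eps. *)
Lemma drift_coordinate_small w (B : set 'rV[R]_n) (sigma e : R) (j : 'I_n) :
  open B -> 0 < sigma -> 0 < e ->
  (forall k : 'rV[int]_n, k != 0 -> \sum_i (k 0 i)%:~R * w 0 i != 0) ->
  \forall eps \near (0 : R)^'+, forall f J th I t,
    perturbation B sigma eps f ->
    hamiltonian_solution B (fun x K => linear_hamiltonian w K + f x K) J th I ->
    J t -> `|t| <= eps^-1 -> `|I t 0 j - I 0 0 j| <= e.
Proof.
move=> oB sigma0 e0 nonres.
pose C := cauchy_const sigma.
have C0 : 0 < C.
  rewrite /C /cauchy_const; apply: addr_gt0; apply: divr_gt0; rewrite ?ltr0n //.
  exact: exprn_gt0.
pose a := Num.min 1 (Num.min (sigma / 8) (e / (20 * C))).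
have a0 : 0 < a by rewrite !lt_min ltr01 !divr_gt0 // mulr_gt0.
have a1 : a <= 1 by rewrite ge_min lexx.
have a2 : 2 * a <= sigma / 4.
  have : a <= sigma / 8 by rewrite !ge_min lexx orbT.
  by move: sigma0; lra.
have a3 : C * (5 * a) <= e / 4.
  have : a <= e / (20 * C) by rewrite !ge_min lexx !orbT.
  by rewrite ler_pdivlMr ?mulr_gt0 //; lra.
(* The precision a ^ 2 is of higher order than the displacement a. *)
have [s [k sk]] := kronecker (a *: 'e_j) (exprn_gt0 2 a0) nonres.
set p := _ - _ in sk.
pose X := 4 * C * (s ^+ 2 * `|w| ^+ 2) / (a * e) + 4 * (`|s| * `|w|) / sigma.
pose M := (Num.truncn X).+1.
have XM : X < M%:R by rewrite truncnS_gt.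
have M0 : 0 < M%:R :> R by rewrite ltr0n.
pose h := s / M%:R.
have hM : M%:R * h = s by rewrite /h; field; rewrite gt_eqF.
have habs : `|h| = `|s| / M%:R by rewrite normrM normfV (ger0_norm (ltW M0)).
have hMabs : `|h| / a * M%:R = `|s| / a.
  by rewrite habs; field; rewrite !gt_eqF.
have X1 : 4 * C * (s ^+ 2 * `|w| ^+ 2) / (a * e) <= M%:R.
  apply: le_trans (ltW XM); rewrite lerDl divr_ge0 ?(ltW sigma0) //.
have X2 : 4 * (`|s| * `|w|) / sigma <= M%:R.
  apply: le_trans (ltW XM); rewrite lerDr; apply: divr_ge0.
    apply: mulr_ge0; last by apply: mulr_ge0; exact: sqr_ge0.
    by apply: mulr_ge0; rewrite ?(ltW C0).
  by rewrite mulr_ge0 ?(ltW a0) ?(ltW e0).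
have hw : `|h| * `|w| <= sigma / 4.
  rewrite habs mulrAC ler_pdivrMr //.
  by move: X2; rewrite ler_pdivrMr //; lra.
have b4 : C * (M%:R * (`|h| * `|w|) ^+ 2 / a) <= e / 4.
  have -> : C * (M%:R * (`|h| * `|w|) ^+ 2 / a) =
      C * (s ^+ 2 * `|w| ^+ 2) / (a * M%:R).
    rewrite habs -[s ^+ 2]real_normK ?num_real //; field.
    by rewrite !gt_eqF.
  rewrite ler_pdivrMr ?mulr_gt0 //; move: X1; rewrite ler_pdivrMr ?mulr_gt0 //.
  by lra.
have cl : (M%:R * h) *: w + map_mx intr k = a *: 'e_j + p.
  by rewrite hM /p [RHS]addrC subrK.
pose Z := `|s| / a * (C ^+ 2 + 2).
have Z0 : 0 <= Z.
  by rewrite mulr_ge0 ?divr_ge0 ?(ltW a0) // addr_ge0 // sqr_ge0.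
have ep0 : 0 < e / (2 * (Z + 1)) by rewrite divr_gt0 // mulr_gt0 // ltr_wpDl.
near=> eps => f J th I t fP sol Jt teps.
have eps0 : 0 < eps by near: eps; exact: nbhs_right_gt.
have epsZ : eps <= e / (2 * (Z + 1)) by near: eps; exact: nbhs_right_le.
have [D jet] := perturbation_jet sigma0 (ltW eps0) fP.
have L0 : 0 <= C * eps by rewrite mulr_ge0 ?(ltW C0) ?(ltW eps0).
have := near_identity_drift sigma0 L0 jet oB
  (fun x K BK => perturbation_bound sigma0 x BK fP)
  (fun x K BK => perturbation_periodic sigma0 x k BK fP) sol Jt cl a0 a1 sk a2 hw.
rewrite hMabs => /le_trans; apply.
have tL : `|t| * (C * eps) <= C.
  rewrite mulrCA ger_pMr // -ler_pdivlMr // mul1r //.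
have s0 : 0 <= `|s| / a by rewrite divr_ge0 // ltW.
set Y := 5 * a + M%:R * (`|h| * `|w|) ^+ 2 / a.
have Y0 : 0 <= Y.
  apply: addr_ge0; first by rewrite mulr_ge0 // ltW.
  by apply: divr_ge0; rewrite ?(ltW a0) // mulr_ge0 // sqr_ge0.
have YC : C * Y <= e / 2 by rewrite mulrDr; clear - a3 b4; lra.
have T1 : `|t| * (C * eps * Y) <= e / 2.
  by rewrite mulrA; apply: le_trans YC; rewrite ler_wpM2r.
have T2 : `|t| * (`|s| / a * (C * eps) ^+ 2) <= `|s| / a * C ^+ 2 * eps.
  have -> : `|t| * (`|s| / a * (C * eps) ^+ 2) = (`|t| * (C * eps)) * (`|s| / a * C * eps).
    by ring.
  apply: (@le_trans _ _ (C * (`|s| / a * C * eps))).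
    by rewrite ler_wpM2r // !mulr_ge0 ?(ltW C0) ?(ltW eps0) // invr_ge0 ltW.
  by rewrite le_eqVlt; apply/orP; left; apply/eqP; ring.
have ZE : `|s| / a * C ^+ 2 * eps + 2 * (`|s| / a * eps) = Z * eps.
  by rewrite /Z; ring.
have Ze : Z * eps <= e / 2.
  move: epsZ; rewrite ler_pdivlMr ?mulr_gt0 // ?ltr_wpDl //.
  by clear - eps0; lra.
rewrite [`|t| * _]mulrDr.
by clear - T1 T2 ZE Ze; lra.
Unshelve. all: by end_near. Qed.

(** The supremum of an empty set would be -oo, so the limit requires that each
    set of drifts is nonempty; the unperturbed flow provides the element 0. *)
Lemma drifts_0 w c (r sigma eps : R) : 0 < r -> 0 < eps ->
  drifts (ball c r) sigma (linear_hamiltonian w) eps 0.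
Proof.
move=> r0 eps0.
exists (fun _ _ => 0), setT, (fun t => 0 + t *: w), (cst c), 0.
have jet0 : quadratic_jet (ball c r) 1 0 (fun _ _ => 0 : R) (fun _ _ _ => 0).
  by split=> *; rewrite ?addr0 ?mulr0 ?subr0 ?normr0 ?mul0r.
have cB : ball c r c by exact: ballxx.
split=> //; last 2 first.
- by rewrite normr0 invr_ge0 ltW.
- by rewrite subrr normr0.
- exists (fun _ => 0); last first.
    apply: ge_ereal_sup => _ [z _ <-]; by rewrite rnorm0 lee_fin ltW.
  by split=> // z _; exact: differentiable_cst.
split=> //; first exact: openT.
move=> t _; split=> //.
- rewrite (gradient_action ltr01 (lexx 0) jet0) //; last exact: ball_open.
  rewrite [X in _ + X](_ : _ = 0) ?addr0; first exact: is_derive_line.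
  by apply/rowP => i; rewrite !mxE.
- rewrite (gradient_angle ltr01 (lexx 0) jet0) //.
  rewrite [X in - X](_ : _ = 0) ?oppr0; first exact: is_derive_cst.
  by apply/rowP => i; rewrite !mxE.
Qed.

End Stability.

Theorem corollary1p2 (R : realType) (n : nat) (c : 'rV[R]_n) (r sigma : R)
    (w : 'rV[R]_n) :
  (2 <= n)%N -> 1 < r -> 0 < sigma -> w != 0 ->
  rationally_steep (ball c r) (linear_hamiltonian w) ->
  effectively_stable (ball c r) sigma (linear_hamiltonian w).
Proof.
move=> _ r1 sigma0 _ steep.
have r0 : 0 < r by rewrite (lt_trans ltr01).
have nonres := rationally_steep_nonresonant r0 steep.
have oB : open (ball c r) by exact: ball_open.
move=> A /= A0.
have /nbhs_ballP[e /= e0 He] : nbhs (0 : R) (fun d => A d%:E) := A0.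
have e20 : 0 < e / 2 by rewrite divr_gt0.
rewrite /nbhs /=; near=> eps.
have eps0 : 0 < eps by near: eps; exact: nbhs_right_gt.
pose S := ereal_sup
  [set d%:E | d in drifts (ball c r) sigma (linear_hamiltonian w) eps].
suff : A S by [].
have S0 : (0%:E <= S)%E.
  by apply: ereal_sup_ubound; exists 0 => //; exact: drifts_0.
have Se : (S <= (e / 2)%:E)%E.
  apply: ge_ereal_sup => _ [d [f [J [th [I [t [fP sol Jt teps ->]]]]]] <-].
  rewrite lee_fin; apply: row_norm_le => [|j]; first exact: ltW.
  rewrite !mxE; move: j f J th I t fP sol Jt teps.
  near: eps; apply: filter_forall => j.
  exact: drift_coordinate_small.
case: (S) S0 Se => [d| |] //=; rewrite !lee_fin => d0 de.
apply: He; rewrite -ball_normE /= sub0r normrN ger0_norm //.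
by apply: le_lt_trans de _; rewrite ltr_pdivrMr //; lra.
Unshelve. all: by end_near. Qed.
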